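(* Let $G$ be a right-orderable group and let $T$ be a $G$-tree with trivial edge stabilisers. Let $H,K$ be subgroups of $G$. Then $$\sum_{g\in H\backslash G/K}\overline{\kappa}_T(H^g\cap K)\;\leq\;\overline{\kappa}_T(H)\,\overline{\kappa}_T(K),$$ where $g$ ranges over a set of representatives of the double cosets $HgK$, $H^g=g^{-1}Hg$, and $\overline{\kappa}_T$ denotes the reduced Kurosh rank with respect to $T$. (All quantities lie in $\mathbb{N}\cup\{\infty\}$, and $0\cdot\infty=0$.)
   Context: A group $G$ is right-orderable if it admits a total order invariant under right multiplication ($a<b$ implies $ac<bc$). Groups act on trees on the right, by graph automorphisms and without edge inversions (edges are oriented and the action preserves orientation, so the quotient by a subgroup is a graph). A $G$-tree is a tree (nonempty) with such an action of $G$; $VT$ and $ET$ denote its vertex and edge sets. Kurosh rank: let $T$ be a $G$-tree with trivial edge stabilisers and $H\leqslant G$. Let $c_T(H)\in\mathbb{N}\cup\{\infty\}$ be the number of $H$-orbits $vH\in VT/H$ of vertices $v$ whose $H$-stabiliser is non-trivial. Let $\mathrm{rank}(T/H)\in\mathbb{N}\cup\{\infty\}$ be the number of edges of the quotient graph $T/H$ outside a maximal subtree (equivalently the rank of the free group $\pi_1(T/H)$). The Kurosh rank of $H$ with respect to $T$ is $\kappa_T(H)=c_T(H)+\mathrm{rank}(T/H)$, and the reduced Kurosh rank is $\overline{\kappa}_T(H)=\max\{0,\kappa_T(H)-1\}$. These may be infinite. *)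

(* Defs.v *)
From HB Require Import structures.
From mathcomp Require Import all_boot all_order all_algebra.
From mathcomp Require Import all_classical all_reals all_analysis.

Set Implicit Arguments.
Unset Strict Implicit.
Unset Printing Implicit Defensive.

Import Order.TTheory GRing.Theory Num.Theory.

Local Open Scope classical_set_scope.
Local Open Scope group_scope.

(* The order is given by its strict part. *)
Definition right_orderable (G : groupType) : Prop :=
  exists lt : rel G,
    [/\ irreflexive lt, transitive lt,
        forall a b, a != b -> lt a b || lt b a &
        forall a b c, lt a b -> lt (a * c) (b * c)].

Definition is_subgroup (G : groupType) (H : set G) : Prop :=
  group_closed [in H].

(* [h ^ g] is [g^-1 * h * g]. *)
Definition conj_set (G : groupType) (H : set G) (g : G) : set G :=
  [set h ^ g | h in H].

Definition double_coset (G : groupType) (H K : set G) (g : G) : set G :=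
  [set x | exists h k, [/\ H h, K k & x = h * g * k]].

Definition double_coset_reps (G : groupType) (H K S : set G) : Prop :=
  forall x, exists! g, S g /\ double_coset H K g x.

(* Oriented graphs; loops and multiple edges are allowed. *)
Record graph := Graph {
  vert : choiceType;
  edge : choiceType;
  src : edge -> vert;
  tgt : edge -> vert }.

Section Trees.
Variable X : graph.

(* [(e, true)] is [e] traversed from [src e] to [tgt e], and [(e, false)] is
   its inverse. *)
Definition step_src (s : edge X * bool) := if s.2 then src s.1 else tgt s.1.
Definition step_tgt (s : edge X * bool) := if s.2 then tgt s.1 else src s.1.

Fixpoint walk (v : vert X) (p : seq (edge X * bool)) (w : vert X) : Prop :=
  if p is s :: p' then step_src s = v /\ walk (step_tgt s) p' w else v = w.

Definition reduced (p : seq (edge X * bool)) : bool :=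
  sorted (fun s t => t != (s.1, ~~ s.2)) p.

(* The subgraph with vertex set [Y.1] and edge set [Y.2] is a tree. *)
Definition is_subtree (Y : set (vert X) * set (edge X)) : Prop :=
  [/\ Y.1 !=set0,
      (forall e, Y.2 e -> Y.1 (src e) /\ Y.1 (tgt e)) &
      (forall v w, Y.1 v -> Y.1 w ->
         exists! p, [/\ walk v p w, reduced p & forall s, s \in p -> Y.2 s.1])].

Definition is_tree : Prop := is_subtree ([set: vert X], [set: edge X]).

Definition is_maximal_subtree (Y : set (vert X) * set (edge X)) : Prop :=
  is_subtree Y /\
  forall Z, is_subtree Z -> Y.1 `<=` Z.1 -> Y.2 `<=` Z.2 -> Z = Y.

(* The number of edges outside a chosen maximal subtree; the default of [xget]
   is irrelevant, as every nonempty graph has a maximal subtree, and for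
   connected graphs the value does not depend on the choice.  Ranks lie
   in the natural numbers with +oo, embedded in the extended reals, where
   0 * +oo = 0 and +oo - 1 = +oo. *)
Definition graph_rank (R : realType) : \bar R :=
  counting (~` (xget (set0, set0) [set Y | is_maximal_subtree Y]).2).

End Trees.

(* Actions are on the right and preserve the orientation of edges. *)
Record gtree (G : groupType) := GTree {
  gtree_graph :> graph;
  gtree_tree : is_tree gtree_graph;
  vact : vert gtree_graph -> G -> vert gtree_graph;
  eact : edge gtree_graph -> G -> edge gtree_graph;
  vact1 : forall v, vact v 1 = v;
  vactM : forall v a b, vact v (a * b) = vact (vact v a) b;
  eact1 : forall e, eact e 1 = e;
  eactM : forall e a b, eact e (a * b) = eact (eact e a) b;
  src_act : forall e a, src (eact e a) = vact (src e) a;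
  tgt_act : forall e a, tgt (eact e a) = vact (tgt e) a }.

Definition trivial_edge_stabilisers (G : groupType) (T : gtree G) : Prop :=
  forall (e : edge T) (g : G), eact e g = e -> g = 1.

Section KuroshRank.
Variables (G : groupType) (T : gtree G) (H : set G).

Definition vorbit (v : vert T) : set (vert T) := [set vact v h | h in H].
Definition eorbit (e : edge T) : set (edge T) := [set eact e h | h in H].

Lemma image_src_eorbit e : (@src T) @` eorbit e = vorbit (src e).
Proof.
rewrite /eorbit /vorbit image_comp; apply: eq_imagel => h _ /=.
exact: src_act.
Qed.

Lemma image_tgt_eorbit e : (@tgt T) @` eorbit e = vorbit (tgt e).
Proof.
rewrite /eorbit /vorbit image_comp; apply: eq_imagel => h _ /=.
exact: tgt_act.
Qed.

Lemma quotient_src_subproof (O : range eorbit) :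
  (@src T) @` val O \in range vorbit.
Proof.
case: O => O /= /set_mem[e _ <-]; apply/mem_set; exists (src e) => //.
by rewrite image_src_eorbit.
Qed.

Lemma quotient_tgt_subproof (O : range eorbit) :
  (@tgt T) @` val O \in range vorbit.
Proof.
case: O => O /= /set_mem[e _ <-]; apply/mem_set; exists (tgt e) => //.
by rewrite image_tgt_eorbit.
Qed.

(* Vertices and edges are the orbits; the source of an orbit of edges is its
   image under [src], which is an orbit of vertices. *)
Definition quotient_graph : graph :=
  @Graph (range vorbit : choiceType) (range eorbit : choiceType)
    (fun O => exist (fun A => A \in range vorbit) _ (quotient_src_subproof O))
    (fun O => exist (fun A => A \in range vorbit) _ (quotient_tgt_subproof O)).

Definition vstab (v : vert T) : set G := [set h | H h /\ vact v h = v].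

Local Open Scope ereal_scope.

Definition nontrivial_orbits (R : realType) : \bar R :=
  counting [set vorbit v | v in [set v | vstab v <> [set 1%g]]].

Definition kurosh_rank (R : realType) : \bar R :=
  nontrivial_orbits R + graph_rank quotient_graph R.

Definition reduced_kurosh_rank (R : realType) : \bar R :=
  Order.max 0 (kurosh_rank R - 1).

End KuroshRank.

(* Main.v *)
Require Import Defs.
From HB Require Import structures.
From mathcomp Require Import all_boot all_order all_algebra.
From mathcomp Require Import all_classical all_reals all_analysis.
From mathcomp Require Import wochoice finmap zify.

Set Implicit Arguments.
Unset Strict Implicit.
Unset Printing Implicit Defensive.

Import Order.TTheory GRing.Theory Num.Theory.

Local Open Scope classical_set_scope.
Local Open Scope group_scope.

(** Following Dicks' form of Mineyev's argument.  Right-orderability of [G] and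
    triviality of the edge stabilisers give a [G]-invariant total order on the
    edges of [T].  For a subgroup [H], call a set of vertices essential if it
    contains [u] and [u h] for some [h <> 1] in [H], and call an edge [e] an
    [H]-bridge if, in the forest of the edges smaller than [e], the components
    of both ends of [e] are essential.

    The reduced Kurosh rank of [H] is the number of [H]-orbits of bridges.
    Indeed, in a finite connected piece of [T/H] made of a subtree with vertex
    set [V] and of [q] further edges, and with [p] marked vertices, there are
    [|V| - 1 + q] edges, so it suffices to match the edges that are not bridges
    with the [|V| - p] unmarked vertices.  A vertex [v] is matched with the
    first edge on the way from [v] to its largest cap, that is, the largest
    edge at the border of an inessential component containing [v].

    Bridges of [H^g & K] are bridges of [H^g] and of [K], and
    [e |-> (e g^-1 H, e K)] is injective on the disjoint union, over the double
    cosets, of the sets of orbits of bridges of the groups [H^g & K]. *)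

(** * Connectivity and forests *)

Section Connectivity.
Variable X : graph.
Implicit Types (Q : set (edge X)) (e f : edge X) (u v w : vert X).

Definition joins e v w := (src e = v /\ tgt e = w) \/ (src e = w /\ tgt e = v).

Inductive conn Q v : vert X -> Prop :=
| Conn0 : conn Q v v
| ConnS w w' e : conn Q v w -> Q e -> joins e w w' -> conn Q v w'.

Lemma joins_sym e v w : joins e v w -> joins e w v.
Proof. by case; [right|left]. Qed.

Lemma joins_src e : joins e (src e) (tgt e). Proof. by left. Qed.

Lemma joins_eq e v w v' w' : joins e v w -> joins e v' w' ->
  (v = v' /\ w = w') \/ (v = w' /\ w = v').
Proof. by case=> -[<- <-] [] [<- <-]; tauto. Qed.

Lemma conn1 Q e v w : Q e -> joins e v w -> conn Q v w.
Proof. by move=> Qe; apply: ConnS Qe => //; exact: Conn0. Qed.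

Lemma conn_trans Q v u w : conn Q v u -> conn Q u w -> conn Q v w.
Proof. by move=> vu; elim=> // x y e _ vx Qe; exact: ConnS vx Qe. Qed.

Lemma conn_sym Q v w : conn Q v w -> conn Q w v.
Proof.
elim=> [|x y e _ xv Qe exy]; first exact: Conn0.
exact: conn_trans (conn1 Qe (joins_sym exy)) xv.
Qed.

Lemma conn_step Q e v w u : Q e -> joins e v w -> conn Q w u -> conn Q v u.
Proof. by move=> Qe evw; exact: conn_trans (conn1 Qe evw). Qed.

Lemma conn_sub Q Q' v w : Q `<=` Q' -> conn Q v w -> conn Q' v w.
Proof.
move=> QQ'; elim=> [|x y e _ vx Qe exy]; first exact: Conn0.
exact: ConnS vx (QQ' _ Qe) exy.
Qed.

(** Up to its first use of [e], a walk avoids [e], and there it stands at an end of [e]. *)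
Lemma conn_split Q e a b v w : joins e a b -> conn Q v w ->
  conn (Q `\ e) v w \/ conn (Q `\ e) v a \/ conn (Q `\ e) v b.
Proof.
move=> eab; elim=> [|x y f _ [vx|vx] Qf fxy]; first by left; exact: Conn0.
- have [fe|fe] := pselect (f = e); last by left; apply: ConnS vx _ fxy.
  rewrite fe in fxy.
  by case: (joins_eq fxy eab) => -[xE _]; rewrite -xE; right; [left|right].
- by right.
Qed.

(** Every edge separates its ends; loops are thereby excluded, as a vertex is always joined to
    itself. *)
Definition acyclic Q := forall e, Q e -> ~ conn (Q `\ e) (src e) (tgt e).

Lemma acyclic_joins Q e v w : acyclic Q -> Q e -> joins e v w ->
  ~ conn (Q `\ e) v w.
Proof. by move=> aQ /aQ ae [] [<- <-] // /conn_sym. Qed.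

Lemma acyclic_neq Q e v w : acyclic Q -> Q e -> joins e v w -> v <> w.
Proof.
by move=> aQ Qe /(acyclic_joins aQ Qe) + vw; apply; rewrite vw; exact: Conn0.
Qed.

(* For [v <> y] in the same component of a forest: [e] is the first edge on the
   path from [v] to [y]. *)
Definition first Q v y e := (exists w, joins e v w) /\ ~ conn (Q `\ e) v y.

Lemma first_exists Q v y : acyclic Q -> conn Q v y -> v <> y ->
  exists e w, [/\ Q e, joins e v w, conn (Q `\ e) w y & first Q v y e].
Proof.
move=> aQ vy vNy.
suff [e [w [Qe evw wy]]] :
    exists e w, [/\ Q e, joins e v w & conn (Q `\ e) w y].
  exists e, w; split=> //; split; first by exists w.
  by move=> /conn_trans /(_ (conn_sym wy)); exact: acyclic_joins.
elim: vy vNy => // y' z g vy' IH Qg gyz vNz.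
have [vEy'|vNy'] := pselect (v = y').
  by exists g, z; split=> //; [rewrite vEy'|exact: Conn0].
have [e [w [Qe evw wy']]] := IH vNy'.
exists e, w; split=> //.
have [ge|gNe] := pselect (g = e); last by apply: ConnS wy' _ gyz; split.
subst g; case: (joins_eq evw gyz) => -[vE wE].
  by case: vNy'.
by case: vNz; rewrite vE.
Qed.

Lemma first_mem Q Q' v y e : Q `<=` Q' -> conn Q v y -> first Q' v y e -> Q e.
Proof.
move=> QQ' vy [_ vNy]; apply: contrapT => Qe; apply: vNy.
apply: conn_sub vy => f Qf; split; first exact: QQ'.
by move=> fe; apply: Qe; rewrite -fe.
Qed.

Lemma first_neq Q v y e : first Q v y e -> v <> y.
Proof. by move=> [_ vNy] vy; apply: vNy; rewrite vy; exact: Conn0. Qed.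

(** Another candidate [f] also touches [v]. The way from [w] to [y] behind the first edge [g] must
    use [f], so it meets an end of [f] and leads back to [v] without [g], closing a cycle through
    [g]. *)
Lemma first_uniq Q v y e e' : acyclic Q -> conn Q v y ->
  first Q v y e -> first Q v y e' -> e = e'.
Proof.
move=> aQ vy fe fe'.
have [g [w [Qg gvw wy _]]] := first_exists aQ vy (first_neq fe).
suff H f : first Q v y f -> f = g by rewrite (H _ fe) (H _ fe').
move=> [[x fvx] fNvy]; apply: contrapT => fNg; apply: fNvy.
have Qgf : (Q `\ f) g by split=> // gf; apply: fNg.
apply: (conn_step Qgf gvw).
have [|] := conn_split fvx wy; first by apply: conn_sub => d [[Qd _] dNf].
have Nwv : ~ conn (Q `\ g) w v.
  by move=> /conn_sym; exact: (acyclic_joins aQ Qg gvw).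
have sub : (Q `\ g) `\ f `<=` Q `\ g by move=> d [].
case=> [/(conn_sub sub)//|wx].
have [fQ|fNQ] := pselect (Q f).
  case: Nwv; apply: ConnS (conn_sub sub wx) _ (joins_sym fvx).
  by split=> // /esym.
apply: conn_sub wy => d [Qd dg]; split=> // df; apply: fNQ; by rewrite -df.
Qed.

Lemma first_not_both Q e v w y : acyclic Q -> conn Q v y -> joins e v w ->
  first Q v y e -> first Q w y e -> False.
Proof.
move=> aQ vy evw [_ Nv] [_ Nw].
have [|] := conn_split evw (conn_sym vy); first by move/conn_sym.
by case=> /conn_sym.
Qed.

(** Otherwise the ends of [e] would be joined through [y] without [e]. *)
Lemma first_either Q e v w y : acyclic Q -> Q e -> joins e v w ->
  first Q v y e \/ first Q w y e.
Proof.
move=> aQ Qe evw.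
have [vy|vNy] := pselect (conn (Q `\ e) v y); last first.
  by left; split=> //; exists w.
right; split; first by exists v; exact: joins_sym.
by move=> /conn_sym /(conn_trans vy); exact: (acyclic_joins aQ Qe evw).
Qed.

End Connectivity.

(** * Reduced walks in forests *)

Section ReducedWalks.
Variable X : graph.
Implicit Types (Q : set (edge X)) (e f : edge X) (u v w : vert X).
Implicit Types (p q : seq (edge X * bool)) (s t : edge X * bool).

Lemma joins_step s : joins s.1 (step_src s) (step_tgt s).
Proof. by case: s => e []; [left|right]. Qed.

Lemma walk_conn Q v p w : walk v p w -> (forall s, s \in p -> Q s.1) ->
  conn Q v w.
Proof.
elim: p v => [|s p IH] v /=; first by move=> -> _; exact: Conn0.
move=> [<- pw] Qp; apply: (conn_step _ (joins_step s)).
  by apply: Qp; rewrite mem_head.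
by apply: IH => // t tp; apply: Qp; rewrite inE tp orbT.
Qed.

Lemma joins_dir e v w : joins e v w ->
  exists b, step_src (e, b) = v /\ step_tgt (e, b) = w.
Proof. by case=> -[<- <-]; [exists true|exists false]. Qed.

Lemma step_tgtN e b : step_tgt (e, ~~ b) = step_src (e, b).
Proof. by case: b. Qed.

Lemma reduced_tail s p : reduced (s :: p) -> reduced p.
Proof. exact: path_sorted. Qed.

(** A step is prepended to a reduced walk, unless the walk begins with the inverse step, which is
    then dropped. As [conn] grows at its far end, the induction runs on the reversed connection. *)
Lemma conn_reduced Q v w : conn Q v w ->
  exists p, [/\ walk v p w, reduced p & forall s, s \in p -> Q s.1].
Proof.
move=> /conn_sym; elim=> [|x y e _ [p [px rp Qp]] Qe exy]; first by exists [::].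
have [b [sb tb]] := joins_dir (joins_sym exy).
case: p px rp Qp => [|s p] /= px rp Qp.
  exists [:: (e, b)]; split; rewrite /= ?tb //.
  by move=> s; rewrite inE => /eqP ->.
have [sE|sN] := eqVneq s (e, ~~ b).
  exists p; split; first 1 last.
  - exact: reduced_tail rp.
  - by move=> t tp; apply: Qp; rewrite inE tp orbT.
  by case: px => _; rewrite sE step_tgtN sb.
exists [:: (e, b), s & p]; split.
- by rewrite /= tb.
- by rewrite /reduced /= sN.
- by move=> t; rewrite inE => /orP[/eqP ->|/Qp].
Qed.

(** By induction the second step [t] uses the first edge from the next vertex. If [s.1] did not
    separate [v] from [w], it would separate that vertex from [w], so [t] would use the edge of [s],
    against reducedness or the absence of loops. *)
Lemma reduced_first Q s p v w : acyclic Q -> walk v (s :: p) w ->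
  reduced (s :: p) -> (forall t, t \in s :: p -> Q t.1) -> first Q v w s.1.
Proof.
move=> aQ; elim: p s v => [|t p IH] s v.
  move=> /= [<- <-] _ Qs; split; first by exists (step_tgt s); exact: joins_step.
  by apply: acyclic_joins (joins_step s) => //; apply: Qs; rewrite mem_head.
move=> [sv pw] red Qp.
have Qs : Q s.1 by apply: Qp; rewrite mem_head.
have Qp' t' : t' \in t :: p -> Q t'.1.
  by move=> tp; apply: Qp; rewrite inE tp orbT.
have ft := IH t _ pw (reduced_tail red) Qp'.
have st : joins s.1 v (step_tgt s) by rewrite -sv; exact: joins_step.
have cv : conn Q (step_tgt s) w.
  exact: (@walk_conn Q _ (t :: p) _ pw Qp').
split; first by exists (step_tgt s).
move=> vw; have [tsE|tsN] := pselect (t.1 = s.1).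
  have tN : t != (s.1, ~~ s.2) by move: red => /= /andP[].
  have tE : t = s.
    move: tsE tN; clear; case: s => e b; case: t => f c /= ->.
    by case: b; case: c; rewrite /= ?eqxx.
  have := acyclic_neq aQ Qs st; apply; rewrite -sv.
  by case: pw; rewrite tE.
have [sf|] := pselect (first Q (step_tgt s) w s.1).
  by apply: tsN; exact: first_uniq aQ cv ft sf.
apply; split; first by exists v; exact: joins_sym.
move=> sw; apply: (acyclic_joins aQ Qs st).
exact: conn_trans vw (conn_sym sw).
Qed.

Lemma reduced_uniq Q p q v w : acyclic Q -> walk v p w -> walk v q w ->
  reduced p -> reduced q ->
  (forall s, s \in p -> Q s.1) -> (forall s, s \in q -> Q s.1) -> p = q.
Proof.
move=> aQ; elim: p v q => [|s p IH] v [|t q] //.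
- move=> vw wq _ rq _ Qq; rewrite -vw in wq.
  by case: (first_neq (reduced_first aQ wq rq Qq)).
- move=> wp vw rp _ Qp _; rewrite -vw in wp.
  by case: (first_neq (reduced_first aQ wp rp Qp)).
move=> wp wq rp rq Qp Qq.
have stE : s.1 = t.1.
  apply: (first_uniq aQ (walk_conn wp Qp)).
    exact: (reduced_first aQ wp rp Qp).
  exact: (reduced_first aQ wq rq Qq).
have Qs : Q s.1 by apply: Qp; rewrite mem_head.
have st : s = t.
  have := acyclic_neq aQ Qs (joins_step s).
  case: wp wq => sv _ [tv _]; move: stE sv tv; clear.
  case: s => e b; case: t => f c /= ->.
  case: b; case: c => //=; rewrite /step_src /step_tgt /= => <- E Ne;
  by case: Ne.
subst t; congr (_ :: _).
apply: (IH (step_tgt s)).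
- by case: wp.
- by case: wq.
- exact: reduced_tail rp.
- exact: reduced_tail rq.
- by move=> t tp; apply: Qp; rewrite inE tp orbT.
- by move=> t tp; apply: Qq; rewrite inE tp orbT.
Qed.

(** Subtrees are handled as connected forests from here on: a way round an edge [e] would give a
    second reduced walk beside [[:: (e, true)]]. *)
Lemma subtreeE (Y : set (vert X) * set (edge X)) : is_subtree Y <->
  [/\ Y.1 !=set0, forall e, Y.2 e -> Y.1 (src e) /\ Y.1 (tgt e),
      forall v w, Y.1 v -> Y.1 w -> conn Y.2 v w & acyclic Y.2].
Proof.
split=> [[Y0 Ye Yp]|[Y0 Ye Yc Ya]]; split=> //.
- move=> v w /Yp /[apply] -[p [[pw _ Qp] _]]; exact: walk_conn pw Qp.
- move=> e Qe /conn_reduced[p [pw rp Qp]].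
  have [Ys Yt] := Ye _ Qe.
  have [p0 [_ up0]] := Yp _ _ Ys Yt.
  have E1 := up0 p; have E2 := up0 [:: (e, true)].
  have pE : p = [:: (e, true)].
    rewrite -E1; last by split=> // s /Qp [].
    by rewrite -E2//; split=> //= s; rewrite inE => /eqP ->.
  have : (Y.2 `\ e) e by apply: (Qp (e, true)); rewrite pE mem_head.
  by case=> _; apply.
- move=> v w Yv Yw; have [p [pw rp Qp]] := conn_reduced (Yc _ _ Yv Yw).
  exists p; split=> // q [qw rq Qq]; exact: (reduced_uniq Ya pw qw rp rq Qp Qq).
Qed.

End ReducedWalks.

(** * Maximal subtrees *)

Lemma conn_map (X Y : graph) (f : vert X -> vert Y) (Q : set (edge X))
    (Q' : set (edge Y)) v w :
  (forall e, Q e -> conn Q' (f (src e)) (f (tgt e))) ->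
  conn Q v w -> conn Q' (f v) (f w).
Proof.
move=> fQ; elim=> [|x y e _ vx Qe exy]; first exact: Conn0.
apply: conn_trans vx _; case: exy => -[<- <-]; first exact: fQ.
by apply: conn_sym; exact: fQ.
Qed.

Lemma conn_exit (X : graph) (Q : set (edge X)) (A : set (vert X)) v w :
  conn Q v w -> A v -> ~ A w ->
  exists e x y, [/\ Q e, joins e x y, A x & ~ A y].
Proof.
elim=> [|x y e vx IH Qe exy] Av // NAy.
have [Ax|NAx] := pselect (A x); first by exists e, x, y.
exact: IH.
Qed.

Section MaximalSubtrees.
Variable X : graph.

Let sub (Y Z : {Y : set (vert X) * set (edge X) | is_subtree Y}) : bool :=
  `[< (sval Y).1 `<=` (sval Z).1 /\ (sval Y).2 `<=` (sval Z).2 >].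

Lemma exists_maximal_subtree (x0 : vert X) : exists Y, @is_maximal_subtree X Y.
Proof.
have [||||[Y tY] maxY] := @Zorn _ sub.
- by move=> Y; apply/asboolP; split.
- move=> Y Z W /asboolP[YZ1 YZ2] /asboolP[ZW1 ZW2]; apply/asboolP.
  by split; [exact: subset_trans ZW1|exact: subset_trans ZW2].
- move=> [[Y1 Y2] tY] [[Z1 Z2] tZ] /asboolP[/= YZ1 YZ2] /asboolP[/= ZY1 ZY2].
  by apply: eq_exist; congr (_, _); apply/seteqP.
- move=> A totA.
  have [->|/set0P[Y0 AY0]] := eqVneq A set0.
    have t0 : is_subtree ([set x0], set0 : set (edge X)).
      apply/subtreeE; split=> //=; first by exists x0.
      by move=> v w -> ->; exact: Conn0.
    by exists (exist _ _ t0).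
  pose U : set (vert X) * set (edge X) :=
    (\bigcup_(Y in A) (sval Y).1, \bigcup_(Y in A) (sval Y).2).
  have tU : is_subtree U.
    apply/subtreeE; split.
    + case: Y0 AY0 => Y0 tY0 AY0; case: (tY0) => -[v Yv] _ _.
      by exists v; exists (exist _ _ tY0).
    + move=> e [Y AY Ye]; have /subtreeE[_ /(_ _ Ye)[? ?] _ _] := svalP Y.
      by split; exists Y.
    + move=> v w [Y AY Yv] [Z AZ Zw].
      have [/asboolP[YZ _]|/asboolP[ZY _]] := totA _ _ AY AZ.
        have /subtreeE[_ _ cZ _] := svalP Z.
        apply: conn_sub (cZ _ _ (YZ _ Yv) Zw) => e Ze; by exists Z.
      have /subtreeE[_ _ cY _] := svalP Y.
      by apply: conn_sub (cY _ _ Yv (ZY _ Zw)) => e Ye; exists Y.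
    + move=> e [Y AY Ye] ce.
      (* A walk is finite, so the whole cycle lies in a single member of the chain. *)
      suff [Z [AZ Ze cZ]] : exists Z, [/\ A Z, (sval Z).2 e &
          conn ((sval Z).2 `\ e) (src e) (tgt e)].
        by have /subtreeE[_ _ _ /(_ _ Ze)] := svalP Z; apply.
      elim: ce => [|x y f _ [Z [AZ Ze cZ]] [[W AW Wf] fNe] fxy].
        by exists Y; split=> //; exact: Conn0.
      have [/asboolP[_ ZW]|/asboolP[_ WZ]] := totA _ _ AZ AW.
        exists W; split=> //; first exact: ZW.
        have Wf' : ((sval W).2 `\ e) f by [].
        by apply: ConnS _ Wf' fxy; apply: conn_sub cZ => g [/ZW].
      exists Z; split=> //.
      have Zf' : ((sval Z).2 `\ e) f by split=> //; exact: WZ.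
      exact: ConnS cZ Zf' fxy.
  exists (exist _ _ tU) => Y AY; apply/asboolP; split=> x Yx; by exists Y.
- exists Y; split=> // Z tZ YZ1 YZ2.
  have := maxY (exist _ _ tZ); rewrite /sub asboolT//= => /(_ isT).
  by case.
Qed.

Lemma maximal_subtree_spanning (Y : set (vert X) * set (edge X)) :
  (forall v w : vert X, conn setT v w) -> is_maximal_subtree Y -> Y.1 = setT.
Proof.
move=> cX [/[dup] tY /subtreeE[[y Yy] Ye Yc Ya] maxY].
apply/seteqP; split=> // v _; apply: contrapT => Yv.
have [e [a [b [_ eab Ya' NYb]]]] := conn_exit (cX y v) Yy Yv.
have NYe : ~ Y.2 e by move=> /Ye [? ?]; case: eab => -[? ?]; subst.
have Ynb f : Y.2 f -> src f <> b /\ tgt f <> b.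
  by move=> /Ye [? ?]; split=> E; subst.
(* Maximality is contradicted by adding an edge [e] that leaves [Y], with its far end [b]. *)
pose Z : set (vert X) * set (edge X) := (b |` Y.1, e |` Y.2).
suff tZ : is_subtree Z.
  have ZY : Z = Y by apply: maxY => // x Yx; right.
  by apply: NYb; rewrite -ZY; left.
have cb u : Z.1 u -> conn Z.2 a u.
  case=> [->|Yu]; first by apply: conn1 eab; left.
  by apply: conn_sub (Yc _ _ Ya' Yu) => f Yf; right.
apply/subtreeE; split.
- by exists b; left.
- move=> f [->|/Ye[? ?]]; last by split; right.
  by case: eab => -[-> ->]; split; [right|left|left|right].
- by move=> u w /cb /conn_sym ua /cb; exact: conn_trans.
- move=> f [->|Yf] cf.
    have {}cf : conn Y.2 a b.
      have {}cf : conn Y.2 (src e) (tgt e) by apply: conn_sub cf => g [[]].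
      by case: eab => -[<- <-] //; exact: conn_sym.
    have [g [x [z [Yg gxz Yx NYz]]]] := conn_exit cf Ya' NYb.
    by have [] := Ye _ Yg; case: gxz => -[<- <-] in Yx NYz *.
  (* Folding [b] onto [a] collapses [e], so a cycle through [f] in [Z] becomes one in [Y]. *)
  pose rho u : vert X := if u == b then a else u.
  have rhoN u : u <> b -> rho u = u by rewrite /rho; case: eqP.
  apply: (Ya _ Yf); have [sf tf] := Ynb _ Yf.
  rewrite -(rhoN _ sf) -(rhoN _ tf); apply: conn_map cf => g [[gE|Yg] gNf].
    have ab : a <> b by move=> E; subst.
    by case: eab; rewrite gE => -[-> ->]; rewrite (rhoN _ ab) /rho eqxx;
      exact: Conn0.
  have [sg tg] := Ynb _ Yg; rewrite (rhoN _ sg) (rhoN _ tg).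
  by apply: conn1 (joins_src g).
Qed.

(* [d] is the distance to the root [r]. *)
Lemma rooted_tree (M : set (edge X)) (r : vert X) :
  acyclic M -> (forall v w, conn M v w) ->
  exists d : vert X -> nat,
    [/\ forall v, d v = 0%N <-> v = r,
        forall v, v <> r -> exists e w, [/\ M e, joins e v w & d v = (d w).+1],
        forall e v w, M e -> joins e v w -> d v = (d w).+1 \/ d w = (d v).+1 &
        forall e e' v w w', M e -> M e' -> joins e v w -> joins e' v w' ->
          d v = (d w).+1 -> d v = (d w').+1 -> e = e'].
Proof.
move=> aM cM.
pose path_to_root v p :=
  [/\ walk v p r, reduced p & forall s : edge X * bool, s \in p -> M s.1].
have /choice[path pathP] : forall v, exists p, path_to_root v p.
  by move=> v; exact: conn_reduced.
(* The path of [v] starts with its first edge [e], and the rest is the path of [w], by uniqueness of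
   reduced walks. *)
have key e v w : M e -> joins e v w -> first M v r e ->
    size (path v) = (size (path w)).+1.
  move=> Me evw fe; case: (pathP v) => wv rv Mv.
  case Ep : (path v) wv rv Mv => [|s p] wv rv Mv.
    by case: (first_neq fe).
  have se : s.1 = e.
    exact: (first_uniq aM (cM v r) (reduced_first aM wv rv Mv) fe).
  case: wv => sv wp.
  have swE : step_tgt s = w.
    have sj := joins_step s; rewrite se sv in sj.
    case: (joins_eq sj evw) => -[// vw].
    by case: (acyclic_neq aM Me evw).
  have [ww rw Mw] := pathP w.
  rewrite /= swE in wp *; congr _.+1; congr size.
  apply: (reduced_uniq aM wp ww (reduced_tail rv) rw) => // t tp.
  by apply: Mv; rewrite inE tp orbT.
exists (fun v => size (path v)); split.
- move=> v; have [wv rv Mv] := pathP v; split.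
    by move/eqP/nilP => pE; rewrite pE in wv.
  move=> vr; case Ep : (path v) wv rv Mv => [//|s p] wv rv Mv.
  by case: (first_neq (reduced_first aM wv rv Mv)).
- move=> v vr; have [e [w [Me evw _ fe]]] := first_exists aM (cM v r) vr.
  by exists e, w; split=> //; exact: key evw fe.
- move=> e v w Me evw; have [fe|fe] := first_either r aM Me evw.
    by left; exact: key evw fe.
  by right; exact: key (joins_sym evw) fe.
- move=> e e' v w w' Me Me' evw evw' dw dw'.
  have H g u : M g -> joins g v u -> size (path v) = (size (path u)).+1 ->
      first M v r g.
    move=> Mg gvu vu; have [//|fe] := first_either r aM Mg gvu.
    have := key _ _ _ Mg (joins_sym gvu) fe; rewrite vu => /eqP.
    by rewrite -addn2 -[X in X == _]addn0 eqn_add2l.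
  exact: (first_uniq aM (cM v r) (H _ _ Me evw dw) (H _ _ Me' evw' dw')).
Qed.

End MaximalSubtrees.

(** * Invariant edge orders *)

Definition invariant_edge_order (G : groupType) (T : gtree G)
    (lt : edge T -> edge T -> Prop) :=
  [/\ forall e, ~ lt e e,
      forall f e g, lt e f -> lt f g -> lt e g,
      forall e f, e <> f -> lt e f \/ lt f e &
      forall e f g, lt e f -> lt (eact e g) (eact f g)].

Lemma eact_inj (G : groupType) (T : gtree G) (e : edge T) :
  trivial_edge_stabilisers T -> injective (eact e).
Proof.
move=> triv a b ab; apply: (mulIg b^-1); rewrite mulgV; apply: (triv e).
by rewrite eactM ab -eactM mulgV eact1.
Qed.

(** Stabilisers being trivial, [c] identifies each orbit of edges with [G] under right
    multiplication, and the order of [G] is transported. Different orbits are compared by a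
    well-ordering [R] of their representatives. *)
Lemma exists_invariant_edge_order (G : groupType) (T : gtree G) :
  right_orderable G -> trivial_edge_stabilisers T ->
  exists lt : edge T -> edge T -> Prop, invariant_edge_order lt.
Proof.
move=> [ltG [irr tr tot inv]] triv.
have [R woR] := well_ordering_principle (edge T).
pose orb (e : edge T) : {pred edge T} := fun f => `[< exists g, f = eact e g >].
have orbP e f : reflect (exists g, f = eact e g) (f \in orb e).
  exact: asboolP.
have orb_act e g : orb (eact e g) = orb e.
  apply/funext => f; apply/asboolP/asboolP => -[k ->].
    by exists (g * k); rewrite eactM.
  by exists (g^-1 * k); rewrite -eactM mulVKg.
have /choice[rep repP] e : exists z, minimum_of R (orb e) z.
  have [|z [? _]] := woR (orb e); last by exists z.
  by exists e; apply/orbP; exists 1; rewrite eact1.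
have rep_uniq e f : orb e = orb f -> rep e = rep f.
  move=> ef; have [|z [_ zu]] := woR (orb e).
    by exists (rep e); case: (repP e).
  by rewrite -(zu _ (repP e)); apply: zu; rewrite ef.
have rep_act e g : rep (eact e g) = rep e by exact/rep_uniq/orb_act.
have /choice[c cP] e : exists g, e = eact (rep e) g.
  have [/orbP[g {2}->] _] := repP e; exists g^-1.
  by rewrite -eactM mulgV eact1.
have c_act e g : c (eact e g) = c e * g.
  apply: (eact_inj triv (e := rep e)).
  by rewrite -{1}(rep_act e g) -cP eactM -cP.
(* [R] is only known through unique minima, so its order properties are read off sets of at most
   three edges. *)
have minR x y z : exists m, [/\ m = x \/ m = y \/ m = z, R m x, R m y & R m z].
  have [|m [[+ mlb] _]] := woR (mem [:: x; y; z]).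
    by exists x; rewrite inE eqxx.
  rewrite !inE => m_in; exists m; split.
  - by case/or3P: m_in => /eqP ->; tauto.
  - by apply: mlb; rewrite !inE eqxx.
  - by apply: mlb; rewrite !inE eqxx orbT.
  - by apply: mlb; rewrite !inE eqxx !orbT.
have totR x y : R x y \/ R y x.
  by have [m [[->|[->|->]] ? ? ?]] := minR x y x; tauto.
have antiR x y : R x y -> R y x -> x = y.
  have Rxx z : R z z by case: (totR z z).
  move=> xy yx; have [|m [_ mu]] := woR (mem [:: x; y]).
    by exists x; rewrite inE eqxx.
  rewrite -(mu x) ?(mu y) //; split; rewrite ?inE ?eqxx ?orbT // => z;
    by rewrite !inE => /orP[] /eqP ->.
have trR y x z : R x y -> R y z -> R x z.
  move=> xy yz; have [m [[|[|]] mE mx my mz]] := minR x y z;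
    rewrite mE // in mx my mz.
    by rewrite (antiR _ _ xy mx).
  by rewrite -(antiR _ _ yz my).
exists (fun e f => (rep e <> rep f /\ R (rep e) (rep f)) \/
                   (rep e = rep f /\ ltG (c e) (c f))); split.
- by move=> e [[]//|[_]]; rewrite irr.
- move=> f e g [[ef Ref]|[ef cef]] [[fg Rfg]|[fg cfg]].
  + left; split; last exact: trR Rfg.
    by move=> eg; apply: ef; apply: antiR => //; rewrite eg.
  + by left; rewrite -fg.
  + by left; rewrite ef.
  + by right; split; [rewrite ef|exact: tr cfg].
- move=> e f eNf; have [ref|ref] := pselect (rep e = rep f).
    have /tot /orP[?|?] : c e != c f.
      by apply/eqP => ce; apply: eNf; rewrite (cP e) (cP f) ref ce.
    + by left; right.
    + by right; right.
  by have [?|?] := totR (rep e) (rep f); [left|right]; left; split=> // /esym.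
- move=> e f g; rewrite !rep_act !c_act => -[?|[? ?]]; [by left|right].
  by split=> //; exact: inv.
Qed.

(** * Matching vertices with edges *)

Lemma finite_set_inj (A B : Type) (f : A -> B) (D : set A) :
  {in D &, injective f} -> finite_set (f @` D) -> finite_set D.
Proof. by move=> /inj_card_eq /eq_finite_set ->. Qed.

Lemma finite_set_max (A : choiceType) (lt : A -> A -> Prop) (D : set A) :
  (forall y x z, lt x y -> lt y z -> lt x z) ->
  (forall x y, x <> y -> lt x y \/ lt y x) ->
  finite_set D -> D !=set0 ->
  exists2 m, D m & forall x, D x -> x = m \/ lt x m.
Proof.
move=> tr tot /finite_seqP[s ->] [x0]; elim: s x0 => // a s IH x0 _.
case: s IH => [_|b s IH].
  by exists a; [rewrite /= inE|move=> x /=; rewrite inE => /eqP ->; left].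
have [|m ms mP] := IH b; first by rewrite /= mem_head.
have [am|aNm] := pselect (a = m \/ lt a m).
  exists m; first by rewrite /= inE ms orbT.
  by move=> x; rewrite /= inE => /orP[/eqP -> //|/mP].
have ma : lt m a by have [|/tot[|]] := pselect (a = m); tauto.
exists a; first by rewrite /= mem_head.
move=> x; rewrite /= inE => /orP[/eqP ->|/mP[->|xm]]; [by left|by right|].
by right; exact: tr ma.
Qed.

Section TreeActions.
Variables (G : groupType) (T : gtree G).
Implicit Types (Q : set (edge T)) (e f : edge T) (v w : vert T) (g : G).

Lemma tree_acyclic : acyclic [set: edge T].
Proof. by have /subtreeE[] := gtree_tree T. Qed.

Lemma tree_conn v w : conn [set: edge T] v w.
Proof. by have /subtreeE[_ _ + _] := gtree_tree T; apply. Qed.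

Lemma vactK g : cancel (@vact _ T ^~ g) (@vact _ T ^~ g^-1).
Proof. by move=> v; rewrite /= -vactM mulgV vact1. Qed.

Lemma vactVK g : cancel (@vact _ T ^~ g^-1) (@vact _ T ^~ g).
Proof. by move=> v; rewrite /= -vactM mulVg vact1. Qed.

Lemma eactK g : cancel (@eact _ T ^~ g) (@eact _ T ^~ g^-1).
Proof. by move=> v; rewrite /= -eactM mulgV eact1. Qed.

Lemma eactVK g : cancel (@eact _ T ^~ g^-1) (@eact _ T ^~ g).
Proof. by move=> v; rewrite /= -eactM mulVg eact1. Qed.

Lemma joins_act e v w g : joins e v w -> joins (eact e g) (vact v g) (vact w g).
Proof. by case=> -[<- <-]; [left|right]; rewrite src_act tgt_act. Qed.

Lemma conn_act Q Q' v w g : (forall e, Q e -> Q' (eact e g)) ->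
  conn Q v w -> conn Q' (vact v g) (vact w g).
Proof.
move=> QQ'; apply: (@conn_map _ _ (@vact _ T ^~ g)) => e /QQ' Qe.
by apply: conn1 Qe _; left; rewrite src_act tgt_act.
Qed.

Lemma first_act v y e g :
  first setT v y e -> first setT (vact v g) (vact y g) (eact e g).
Proof.
move=> [[w evw] Nvy]; split; first by exists (vact w g); exact: joins_act.
move=> /(@conn_act _ (setT `\ e) _ _ g^-1); rewrite !vactK => H; apply: Nvy.
by apply: H => f [_ fNe]; split=> // E; apply: fNe; rewrite -E eactVK.
Qed.

End TreeActions.

Lemma subgroupP (G : groupType) (H : set G) : is_subgroup H ->
  [/\ H 1, forall a, H a -> H a^-1 & forall a b, H a -> H b -> H (a * b)].
Proof.
move=> HH; split.
- by case: HH => /set_mem.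
- by move=> a Ha; apply/set_mem; apply: (group_closedV HH); exact/mem_set.
- move=> a b Ha Hb; apply/set_mem; apply: (group_closedM HH); exact/mem_set.
Qed.

Section Components.
Variables (G : groupType) (T : gtree G) (lt : edge T -> edge T -> Prop).
Variable H : set G.
Implicit Types (P Q L : set (edge T)) (e f : edge T) (v w u : vert T) (h : G).

Definition comp Q v : set (vert T) := [set w | conn Q v w].
(** In use, [P] is [setT] or the preimage in [T] of a finite set of edges of [T/H]. *)
Definition below P e : set (edge T) := [set f | P f /\ lt f e].
Definition upto P e : set (edge T) := [set f | P f /\ (f = e \/ lt f e)].

(* The set of vertices [U] embeds into the quotient by [H], and contains no
   vertex with a nontrivial stabiliser. *)
Definition inessential (U : set (vert T)) :=
  forall u h, H h -> U u -> U (vact u h) -> h = 1.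

Lemma inessentialS U U' : U `<=` U' -> inessential U' -> inessential U.
Proof. by move=> UU' iU u h Hh /UU' Uu /UU'; exact: iU. Qed.

(* [f] is an edge leaving, towards [y], a finite tree of edges smaller than [f]
   that contains [v]. *)
Definition capped P v f y :=
  [/\ P f, inessential (comp (below P f) v) &
      exists x, joins f x y /\ conn (below P f) v x].

Definition top P v f y := capped P v f y /\
  forall f' y', capped P v f' y' -> f' = f \/ lt f' f.

(* The vertex [v] is matched with the first edge on the way to its largest
   cap. *)
Definition up P v e := exists f y, top P v f y /\ first setT v y e.

Hypotheses (triv : trivial_edge_stabilisers T)
  (ord : invariant_edge_order lt) (HH : is_subgroup H).

Let ltN e : ~ lt e e. Proof. by case: ord. Qed.
Let lt_tr f e g : lt e f -> lt f g -> lt e g.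
Proof. by case: ord => _ + _ _; apply. Qed.
Let lt_tot e f : e <> f -> lt e f \/ lt f e.
Proof. by case: ord => _ _ + _; apply. Qed.
Let lt_act e f g : lt e f -> lt (eact e g) (eact f g).
Proof. by case: ord => _ _ _; apply. Qed.

Lemma belowS P f f' : lt f f' -> below P f `<=` below P f'.
Proof. by move=> ff' e [? ?]; split=> //; exact: lt_tr ff'. Qed.

Lemma below_joins P f x y : joins f x y -> ~ conn (below P f) x y.
Proof.
move=> fxy xy; apply: (acyclic_joins (@tree_acyclic _ T) I fxy).
by apply: conn_sub xy => e [_ ef]; split=> // E; apply: (@ltN f); rewrite -{1}E.
Qed.

Lemma capped_far P v f y : capped P v f y -> ~ conn (below P f) v y.
Proof.
move=> [_ _ [x [fxy vx]]] vy; apply: (below_joins fxy (P := P)).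
exact: conn_trans (conn_sym vx) vy.
Qed.

Lemma capped_uniq P v f y y' : capped P v f y -> capped P v f y' -> y = y'.
Proof.
move=> cy cy'; have [_ _ [x [fxy vx]]] := cy; have [_ _ [x' [fxy' vx']]] := cy'.
have [[]//|[xE yE]] := joins_eq fxy fxy'.
by case: (capped_far cy); rewrite yE.
Qed.

Lemma capped_conn P v f y : capped P v f y -> conn (upto P f) v y.
Proof.
move=> [Pf _ [x [fxy vx]]]; apply: (@ConnS _ _ _ x y f) => //.
  by apply: conn_sub vx => e [? ?]; split=> //; right.
by split=> //; left.
Qed.

Lemma capped_move P v w f y : capped P v f y -> conn (below P f) v w ->
  capped P w f y.
Proof.
move=> [Pf iv [x [fxy vx]]] vw; split=> //.
  by apply: inessentialS iv => u wu; exact: conn_trans wu.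
by exists x; split=> //; exact: conn_trans (conn_sym vw) vx.
Qed.

(** The way from [v] to the far end of its top cap [f] stays in [upto P f], so [e] is [f] or
    smaller, and the component of [v] below [e] lies in the one below [f]. *)
Lemma up_edge P v e : up P v e ->
  [/\ P e, inessential (comp (below P e) v) & exists w, joins e v w].
Proof.
move=> [f [y [[cf _] fe]]]; have [evw _] := fe.
have [] := first_mem (@subsetT _ _) (capped_conn cf) fe => Pe ef; split=> //.
have [_ iv _] := cf; case: ef => [->//|ef].
by apply: inessentialS iv => u; apply: conn_sub; exact: belowS.
Qed.

Lemma up_unmarked P v e h : up P v e -> H h -> vact v h = v -> h = 1.
Proof.
move=> /up_edge[_ iv _] Hh vh; apply: (iv v h Hh); rewrite /comp /= ?vh;
exact: Conn0.
Qed.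

Lemma up_uniq P v e e' : up P v e -> up P v e' -> e = e'.
Proof.
move=> [f [y [[cf mf] fe]]] [f' [y' [[cf' mf'] fe']]].
have ff' : f = f'.
  have [//|ff'] := mf' _ _ cf; have [//|f'f] := mf _ _ cf'.
  by case: (@ltN f); exact: lt_tr f'f.
subst f'; have yy' := capped_uniq cf cf'; subst y'.
exact: first_uniq (@tree_acyclic _ T) (tree_conn v y) fe fe'.
Qed.

(** * Existence and injectivity of the matching *)

Section Invariant.
Variable P : set (edge T).
Hypothesis PH : forall e h, H h -> P e -> P (eact e h).

Let H1 : H 1. Proof. by have [] := subgroupP HH. Qed.
Let HV h : H h -> H h^-1. Proof. by have [_ + _] := subgroupP HH; apply. Qed.

Lemma below_act e f h : H h -> below P e f -> below P (eact e h) (eact f h).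
Proof. by move=> Hh [Pf fe]; split; [exact: PH|exact: lt_act]. Qed.

Lemma inessential_act e v h : H h -> inessential (comp (below P e) v) ->
  inessential (comp (below P (eact e h)) (vact v h)).
Proof.
have [_ _ HM] := subgroupP HH => Hh iv u k Hk vu vuk.
have pull x : conn (below P (eact e h)) (vact v h) x ->
    conn (below P e) v (vact x h^-1).
  move=> /(@conn_act _ _ _ (below P e) _ _ h^-1); rewrite vactK; apply.
  by move=> f /(below_act (HV Hh)); rewrite eactK.
have := iv (vact u h^-1) (k ^ h^-1) _ (pull _ vu).
rewrite -vactM conjgE invgK !mulgA mulVg mul1g vactM => /(_ _ (pull _ vuk)).
move=> E; have {E} : h * k * h^-1 = 1.
  by apply: E; apply: (HM _ _ (HM _ _ Hh Hk)); exact: HV.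
move=> E; apply: (mulgI h); rewrite mulg1; apply: (mulIg h^-1).
by rewrite E mulgV.
Qed.

Lemma capped_act v f y h : H h -> capped P v f y ->
  capped P (vact v h) (eact f h) (vact y h).
Proof.
move=> Hh [Pf iv [x [fxy vx]]]; split; first exact: PH.
  exact: inessential_act.
exists (vact x h); split; first exact: joins_act.
by apply: conn_act vx => e; exact: below_act.
Qed.

Lemma up_act v e h : H h -> up P v e -> up P (vact v h) (eact e h).
Proof.
move=> Hh [f [y [[cf mf] fe]]]; exists (eact f h), (vact y h).
split; last exact: first_act.
split; first exact: capped_act.
move=> f' y' /(capped_act (HV Hh)); rewrite vactK => /mf[<-|].
  by left; rewrite eactVK.
by move=> /(@lt_act _ _ h); rewrite eactVK; right.
Qed.

(** [up_inj] relies on this to exclude an edge matched with both of its ends. *)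
Lemma inessential_merge e v w : P e -> joins e v w ->
  inessential (comp (below P e) v) -> inessential (comp (below P e) w) ->
  inessential (comp (upto P e) v).
Proof.
move=> Pe evw iv iw u h Hh.
have split_upto x : conn (upto P e) v x ->
    conn (below P e) v x \/ conn (below P e) w x.
  have sub : upto P e `\ e `<=` below P e by move=> f [[? []]].
  move=> /conn_sym /(conn_split evw) [|[|]] /(conn_sub sub) /conn_sym; tauto.
(* As [lt] is invariant, one of [e h] and [e h^-1] is smaller than [e], and
   then the whole path from [u h] to [u h h], or from [u h^-1] to [u], is made
   of edges smaller than [e]. *)
have cross v' w' : joins e v' w' -> inessential (comp (below P e) v') ->
    inessential (comp (below P e) w') -> forall u h, H h ->
    conn (below P e) v' u -> conn (below P e) w' (vact u h) -> h = 1.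
  move=> {u h Hh} ev'w' iv' iw' u h Hh v'u w'uh; apply: contrapT => hN1.
  have uuh : conn (upto P e) u (vact u h).
    have sub : below P e `<=` upto P e by move=> f [? ?]; split=> //; right.
    apply: conn_trans (conn_sub sub (conn_sym v'u)) _.
    apply: (@conn_step _ _ e v' w') => //; first by split=> //; left.
    exact: conn_sub sub w'uh.
  have move_path k : H k -> lt (eact e k) e ->
      conn (below P e) (vact u k) (vact (vact u h) k).
    move=> Hk ke; apply: conn_act uuh => f [Pf fe]; split; first exact: PH.
    case: fe => [->//|fe]; exact: lt_tr (lt_act k fe) ke.
  have ehN : eact e h <> e by move=> /triv.
  case: (lt_tot ehN) => he.
    apply: hN1; apply: (iw' (vact u h) h Hh w'uh).
    exact: conn_trans w'uh (move_path _ Hh he).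
  have hVe : lt (eact e h^-1) e by move/(@lt_act _ _ h^-1): he; rewrite eactK.
  have := move_path _ (HV Hh) hVe; rewrite vactK => uhVu.
  apply: hN1; apply: (iv' (vact u h^-1) h Hh); rewrite /comp /= ?vactVK //.
  by apply: conn_trans v'u _; exact: conn_sym.
move=> /split_upto[vu|wu] /split_upto[vuh|wuh].
- exact: (iv u h Hh vu vuh).
- exact: (cross v w evw iv iw u h Hh vu wuh).
- exact: (cross w v (joins_sym evw) iw iv u h Hh wu vuh).
- exact: (iw u h Hh wu wuh).
Qed.

Hypothesis Pfin : finite_set [set eorbit H e | e in P].

Lemma eorbitP e f : eorbit H e = eorbit H f -> exists2 h, H h & f = eact e h.
Proof.
move=> ef; have : eorbit H f f by exists 1 => //; rewrite eact1.
by rewrite -ef => -[h Hh <-]; exists h.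
Qed.

Lemma finite_transverse (D : set (edge T)) : D `<=` P ->
  (forall e h, H h -> D e -> D (eact e h) -> h = 1) -> finite_set D.
Proof.
move=> DP DH; apply: (@finite_set_inj _ _ (eorbit H)).
  move=> e f /set_mem De /set_mem Df /eorbitP[h Hh fE].
  by rewrite fE (DH e h) ?eact1 // -fE.
by apply: sub_finite_set Pfin => _ [e /DP Pe <-]; exists e.
Qed.

(** Caps [f < f h] of [v] cannot lie in one orbit: the component of [v] below [f h] contains both
    ends of [f] and one end of [f h], hence some [u] and [u h]. *)
Lemma finite_caps v : finite_set [set f | exists y, capped P v f y].
Proof.
have aux f y h z : H h -> capped P v f y -> capped P v (eact f h) z ->
    lt f (eact f h) -> h = 1.
  move=> Hh cf cf' ffh; have [Pf _ [x [fxy vx]]] := cf.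
  have [_ iv [x' [fxy' vx']]] := cf'.
  have vx2 : conn (below P (eact f h)) v x.
    by apply: conn_sub vx; exact: belowS.
  have vy2 : conn (below P (eact f h)) v y by apply: ConnS vx2 _ fxy.
  case: (joins_eq fxy' (joins_act h fxy)) => -[xE _].
    by apply: (iv x h Hh vx2); rewrite /comp /= -xE.
  by apply: (iv y h Hh vy2); rewrite /comp /= -xE.
apply: finite_transverse => [f [y []]//|f h Hh [y cf] [z cf']].
apply: contrapT => hN1; have fhN : f <> eact f h by move=> /esym /triv.
case: (lt_tot fhN) => ffh; apply: hN1; first exact: aux cf cf' ffh.
rewrite -[h]invgK (aux (eact f h) z h^-1 y) ?invg1 ?eactK //; exact: HV.
Qed.

Lemma top_exists v e w : capped P v e w ->
  exists f y, top P v f y /\ (e = f \/ lt e f).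
Proof.
move=> ce; have [|f [y cf] mf] := finite_set_max lt_tr lt_tot (finite_caps v).
  by exists e, w.
exists f, y; split; last by apply: mf; exists w.
by split=> // f' y' cf'; apply: mf; exists y'.
Qed.

Lemma up_exists_of_capped v e w : capped P v e w -> exists f, up P v f.
Proof.
move=> /top_exists[f [y [tf _]]]; have [cf _] := tf.
have vNy : v <> y by move=> E; apply: (capped_far cf); rewrite E; exact: Conn0.
have [g [x [_ _ _ fg]]] := first_exists (@tree_acyclic _ T) (tree_conn v y) vNy.
by exists g, f, y.
Qed.

(** The edge [e] caps [v]. Unless it is the top cap, it lies below the top cap [f], which is then
    the top cap of [w] as well, and [e] is the first edge towards [y] from one of its ends. *)
Lemma up_onto e v w : P e -> joins e v w -> inessential (comp (below P e) v) ->
  up P v e \/ up P w e.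
Proof.
move=> Pe evw iv.
have ce : capped P v e w by split=> //; exists v; split=> //; exact: Conn0.
have [f [y [tf ef]]] := top_exists ce.
have [fe|ef'] := pselect (f = e).
  subst f; left; exists e, y; split=> //; have [cf _] := tf.
  rewrite (capped_uniq cf ce); split; first by exists w.
  exact: (acyclic_joins (@tree_acyclic _ T) I evw).
have {ef ef'} ef : lt e f by case: ef => // /esym.
have [cf mf] := tf; have bef : below P f e by [].
have vw : conn (below P f) v w by exact: conn1 bef evw.
have tw : top P w f y.
  split; first exact: capped_move cf vw.
  move=> f' y' cf'; apply: contrapT => Nf'f.
  have ff' : lt f f' by have [|/lt_tot[|]] := pselect (f' = f); tauto.
  apply: Nf'f; apply: (mf f' y'); apply: capped_move cf' _.
  by apply: conn_sym; apply: conn_sub vw; exact: belowS.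
have [fe|fe] := first_either y (@tree_acyclic _ T) I evw.
  by left; exists f, y.
by right; exists f, y.
Qed.

(** The smallest edge [g] of [P] leaving [U] is a cap: [L] is an initial segment, so all of it is
    below [g], and nothing below [g] leaves [U]. *)
Lemma capped_extend v L : L `<=` P ->
  (forall f g, P f -> L g -> lt f g -> L f) ->
  inessential (comp L v) -> ~ inessential (comp P v) ->
  exists g y, capped P v g y /\ ~ L g.
Proof.
move=> LP Ldown iL NiP; pose U := comp L v.
pose cut g x y := [/\ P g, joins g x y, U x & ~ U y].
pose D := [set g | exists x y, cut g x y].
have Uv : U v by exact: Conn0.
have Ucut x y : conn P x y -> U x -> ~ U y -> D !=set0.
  move=> xy Ux NUy; have [g [a [b [Pg gab Ua NUb]]]] := conn_exit xy Ux NUy.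
  by exists g, a, b.
have D0 : D !=set0.
  have [x vx NUx] : exists2 x, conn P v x & ~ U x.
    apply: contrapT => NE; apply: NiP; apply: inessentialS iL => x vx.
    by apply: contrapT => NUx; apply: NE; exists x.
  exact: Ucut vx Uv NUx.
have Dfin : finite_set D.
  (* As [U] is inessential, the leaving edges with source in [U], and those with target in [U], meet
     each orbit at most once. *)
  have -> : D = [set g | cut g (src g) (tgt g)] `|` [set g | cut g (tgt g) (src g)].
    apply/seteqP; split=> g.
      move=> [x [y [Pg gxy Ux NUy]]].
      by case: (gxy) => -[E1 E2]; [left|right]; split; rewrite ?E1 ?E2 //;
        rewrite -E1 -E2 in gxy *.
    by case=> cg; [exists (src g), (tgt g)|exists (tgt g), (src g)].
  rewrite finite_setU; split; apply: finite_transverse.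
  - by move=> g [].
  - move=> g h Hh [_ _ Ug _] [_ _ + _]; rewrite src_act; exact: iL Hh Ug.
  - by move=> g [].
  - move=> g h Hh [_ _ Ug _] [_ _ + _]; rewrite tgt_act; exact: iL Hh Ug.
have [g [x [y [Pg gxy Ux NUy]]] ming] := @finite_set_max _ (fun e f => lt f e) D
  (fun y x z xy yz => lt_tr yz xy)
  (fun x y xy => lt_tot (fun E => xy (esym E))) Dfin D0.
have NLg : ~ L g by move=> Lg; apply: NUy; exact: ConnS Ux Lg gxy.
have Lbelow : L `<=` below P g.
  move=> f Lf; split; first exact: LP.
  have [fg|/lt_tot[//|gf]] := pselect (f = g); first by rewrite -fg in NLg.
  by case: NLg; exact: Ldown Pg Lf gf.
exists g, y; split=> //; split=> //; last first.
  by exists x; split=> //; exact: conn_sub Ux.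
apply: inessentialS iL => u vu; apply: contrapT => NUu.
have [f [a [b [[Pf fg] fab Ua NUb]]]] := conn_exit vu Uv NUu.
have [|fE|gf] := ming f; first by exists a, b.
  by case: (@ltN g); rewrite -{1}fE.
by case: (@ltN g); exact: lt_tr fg.
Qed.

(** For [L = set0] the component of [v] is [v] alone, inessential because its stabiliser is
    trivial. *)
Lemma up_exists v : (forall h, H h -> vact v h = v -> h = 1) ->
  ~ inessential (comp P v) -> exists e, up P v e.
Proof.
move=> vfree NiP.
have comp0 u : conn set0 v u -> u = v by elim.
have [|||g [y [cg _]]] := @capped_extend v set0 _ _ _ NiP => //.
  by move=> u h Hh /comp0 -> /comp0; exact: vfree.
exact: up_exists_of_capped cg.
Qed.

(** Suppose [e] is matched with both of its ends. If the top cap of [v] were larger than [e], both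
    ends would share their top cap, and [e] cannot be the first edge towards it from both. So [e] is
    the top cap of [v]; but the merged component up to [e] is inessential, and [capped_extend]
    yields a larger cap. *)
Lemma up_inj v w e : ~ inessential (comp P v) -> up P v e -> up P w e -> v = w.
Proof.
move=> NiP ue ue'; apply: contrapT => vNw.
have [f [y [[cf mf] fe]]] := ue; have [f' [y' [[cf' mf'] fe']]] := ue'.
have evw : joins e v w.
  have [[x evx] _] := fe; have [[x' ewx'] _] := fe'.
  by have [[]//|[_ xw]] := joins_eq evx ewx'; rewrite -xw.
have far g a b z : joins e a b -> capped P b g z -> first setT b z e -> e <> g ->
    lt e g /\ conn (below P g) b a.
  move=> eab cg fz eNg.
  have [Pe [//|eg]] := first_mem (@subsetT _ _) (capped_conn cg) fz; split=> //.
  exact: conn1 (joins_sym eab).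
have ef : e = f.
  apply: contrapT => eNf.
  have [lef vw] := far _ _ _ _ (joins_sym evw) cf fe eNf.
  have cfw := capped_move cf vw; have [ff'|ff'] := mf' _ _ cfw.
    subst f'; have yy' := capped_uniq cf' cfw; subst y'.
    exact: first_not_both (@tree_acyclic _ T) (tree_conn v y) evw fe fe'.
  have lef' : lt e f' by exact: lt_tr ff'.
  have eNf' : e <> f' by move=> E; apply: (@ltN e); rewrite {2}E.
  have [_ wv] := far _ _ _ _ evw cf' fe' eNf'.
  have [f'f|f'f] := mf _ _ (capped_move cf' wv).
    by apply: (@ltN f); rewrite -{2}f'f.
  by apply: (@ltN f); exact: lt_tr f'f.
subst f; have [Pe iv _] := up_edge ue; have [_ iw _] := up_edge ue'.
have iU := inessential_merge Pe evw iv iw.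
have [||g [z [cg NLg]]] := @capped_extend v (upto P e) _ _ iU NiP => //.
- by move=> f [].
- move=> f g Pf [_ [->|ge]] fg; split=> //; right => //; exact: lt_tr ge.
by apply: NLg; split; [case: cg|exact: mf cg].
Qed.

End Invariant.
End Components.

(** * Quotient graphs *)

Section RootedPairs.
Variables (X : graph) (M : set (edge X)) (r : vert X) (d : vert X -> nat).
Hypotheses (d0 : forall v, d v = 0%N <-> v = r)
  (d_up : forall v, v <> r -> exists e w, [/\ M e, joins e v w & d v = (d w).+1])
  (d_uniq : forall e e' v w w', M e -> M e' -> joins e v w -> joins e' v w' ->
    d v = (d w).+1 -> d v = (d w').+1 -> e = e').

(* [V] and [E] are the vertices and the edges of a finite subtree of the tree
   [M] containing the root. *)
Definition rooted_pair (V : {fset vert X}) (E : {fset edge X}) :=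
  [/\ r \in V,
      forall e v w, M e -> joins e v w -> d v = (d w).+1 -> v \in V -> w \in V,
      #|` V|%fset = #|` E|%fset.+1 &
      forall e, e \in E <->
        M e /\ exists v w, [/\ v \in V, joins e v w & d v = (d w).+1]].

Lemma rooted_pair_root : rooted_pair [fset r]%fset fset0.
Proof.
have dr : d r = 0%N by exact/d0.
split; first by rewrite inE.
- by move=> e v w _ _ + /[!inE]/eqP vr; rewrite vr dr.
- by rewrite cardfs1 cardfs0.
- move=> e; rewrite inE; split=> // -[_ [v [w [/[!inE]/eqP-> _]]]].
  by rewrite dr.
Qed.

(** Induction on the distance to the root: the parent [w] is added first, then [v] together with its
    parent edge. *)
Lemma rooted_pair_add1 V E v : rooted_pair V E ->
  exists V' E', [/\ rooted_pair V' E', v \in V' & (V `<=` V')%fset].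
Proof.
move: {2}(d v) (erefl (d v)) => n; elim: n v => [|n IH] v dv VE.
  by exists V, E; split=> //; have /d0 -> := dv; case: VE.
have [|e [w [Me evw dvw]]] := d_up (v := v); first by move/d0; rewrite dv.
have [|V' [E' [VE' wV' VV']]] := IH w _ VE.
  by apply: succn_inj; rewrite -dvw.
have [vV'|vV'] := boolP (v \in V'); first by exists V', E'.
have [rV' closed cardV' memE'] := VE'.
exists (v |` V')%fset, (e |` E')%fset; split; last 2 first.
- by rewrite !inE eqxx.
- exact: fsubset_trans VV' (fsubsetU1 _ _).
have lower a b : joins e a b -> d a = (d b).+1 -> a = v.
  move=> eab dab; have [[]//|[vb wa]] := joins_eq evw eab.
  move: dvw; rewrite wa dab vb => /eqP.
  by rewrite -addn2 -[X in X == _]addn0 eqn_add2l.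
have eE' : e \notin E'.
  apply/negP => /memE'[_ [a [b [aV' eab dab]]]].
  by move: vV'; rewrite -(lower _ _ eab dab) aV'.
split.
- by rewrite !inE rV' orbT.
- move=> f a b Mf fab dab; rewrite !inE => /orP[/eqP av|aV'].
    subst a; have fe := d_uniq Mf Me fab evw dab dvw; subst f.
    have [[_ ->]|[vw _]] := joins_eq fab evw; first by rewrite wV' orbT.
    by move: dvw; rewrite vw => /eqP; rewrite -addn1 -[X in X == _]addn0 eqn_add2l.
  by rewrite (closed f a b) ?orbT.
- by rewrite !cardfsU1 vV' eE' cardV'.
- move=> f; rewrite !inE; split.
    move=> /orP[/eqP->|/memE'[Mf [a [b [aV' fab dab]]]]].
      by split=> //; exists v, w; rewrite !inE eqxx.
    by split=> //; exists a, b; rewrite !inE aV' orbT.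
  move=> [Mf [a [b [+ fab dab]]]]; rewrite !inE => /orP[/eqP av|aV'].
    by subst a; rewrite (d_uniq Mf Me fab evw dab dvw) eqxx.
  by apply/orP; right; apply/memE'; split=> //; exists a, b.
Qed.

Lemma rooted_pair_exists (W : seq (vert X)) :
  exists V E, rooted_pair V E /\ {subset W <= V}.
Proof.
elim: W => [|v W [V [E [VE WV]]]].
  by exists [fset r]%fset, fset0; split=> //; exact: rooted_pair_root.
have [V' [E' [VE' vV' /fsubsetP VV']]] := rooted_pair_add1 v VE.
exists V', E'; split=> // u; rewrite inE => /orP[/eqP->//|/WV]; exact: VV'.
Qed.

End RootedPairs.

(** * The quotient of the tree by a subgroup *)

Section Quotient.
Variables (G : groupType) (T : gtree G) (H : set G).
Hypothesis HH : is_subgroup H.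
Notation X := (quotient_graph T H).
Implicit Types (e f : edge T) (v w : vert T).

Definition qv v : vert X :=
  exist (fun A => A \in range (@vorbit G T H)) (vorbit H v)
    (mem_set (imageT (vorbit H) v)).

Definition qe e : edge X :=
  exist (fun A => A \in range (@eorbit G T H)) (eorbit H e)
    (mem_set (imageT (eorbit H) e)).

Lemma qv_surj x : exists v, qv v = x.
Proof.
case: x => A Ar; have /set_mem[v _ vA] := Ar; exists v.
exact: val_inj.
Qed.

Lemma qe_surj x : exists e, qe e = x.
Proof.
case: x => A Ar; have /set_mem[e _ eA] := Ar; exists e.
exact: val_inj.
Qed.

Lemma qv_act v h : H h -> qv (vact v h) = qv v.
Proof.
have [_ HV HM] := subgroupP HH => Hh; apply: val_inj => /=.
apply/seteqP; split=> _ [k Hk <-].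
  by exists (h * k); rewrite ?vactM //; exact: HM.
by exists (h^-1 * k); rewrite -?vactM ?mulVKg //; apply: HM => //; exact: HV.
Qed.

Lemma qe_act e h : H h -> qe (eact e h) = qe e.
Proof.
have [_ HV HM] := subgroupP HH => Hh; apply: val_inj => /=.
apply/seteqP; split=> _ [k Hk <-].
  by exists (h * k); rewrite ?eactM //; exact: HM.
by exists (h^-1 * k); rewrite -?eactM ?mulVKg //; apply: HM => //; exact: HV.
Qed.

Lemma qvP v w : qv v = qv w -> exists2 h, H h & w = vact v h.
Proof.
have [H1 _ _] := subgroupP HH => /(congr1 val) /= vw.
have : vorbit H w w by exists 1 => //; rewrite vact1.
by rewrite -vw => -[h Hh <-]; exists h.
Qed.

Lemma qeP e f : qe e = qe f -> exists2 h, H h & f = eact e h.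
Proof. by move=> /(congr1 val) /= /(eorbitP HH). Qed.

Lemma src_qe e : src (qe e) = qv (src e).
Proof. by apply: val_inj => /=; rewrite image_src_eorbit. Qed.

Lemma tgt_qe e : tgt (qe e) = qv (tgt e).
Proof. by apply: val_inj => /=; rewrite image_tgt_eorbit. Qed.

Lemma joins_qe e v w : joins e v w -> joins (qe e) (qv v) (qv w).
Proof. by case=> -[<- <-]; [left|right]; rewrite src_qe tgt_qe. Qed.

Lemma joins_lift e x y : joins (qe e) x y ->
  exists v w, [/\ joins e v w, qv v = x & qv w = y].
Proof.
rewrite /joins src_qe tgt_qe => -[] [<- <-].
  by exists (src e), (tgt e); split=> //; left.
by exists (tgt e), (src e); split=> //; right.
Qed.

Lemma quotient_conn (x y : vert X) : conn setT x y.
Proof.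
have [[v <-] [w <-]] := (qv_surj x, qv_surj y).
apply: (conn_map (Q := setT)) (tree_conn v w) => e _.
by apply: (conn1 (e := qe e)) => //; rewrite -src_qe -tgt_qe; left.
Qed.

Definition marked : set (vert X) :=
  [set qv v | v in [set v | vstab H v <> [set 1]]].

Lemma markedPn v : ~ marked (qv v) -> forall h, H h -> vact v h = v -> h = 1.
Proof.
move=> Nv h Hh vh; apply: contrapT => hN1; apply: Nv; exists v => //= E.
by have : vstab H v h by []; rewrite E.
Qed.

(** Vertices in one orbit have conjugate stabilisers. *)
Lemma marked_stab v : marked (qv v) ->
  (forall h, H h -> vact v h = v -> h = 1) -> False.
Proof.
have [H1 HV HM] := subgroupP HH.
move=> [w /= Nw /qvP[k Hk ->]] free; apply: Nw.
apply/seteqP; split=> [h [Hh wh] /=|_ ->]; last by split; rewrite ?vact1.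
apply: (@conjg_inj _ k); rewrite conj1g; apply: free.
  exact: (HM _ _ (HV _ Hk) (HM _ _ Hh Hk)).
by rewrite -vactM conjgE mulVKg vactM wh.
Qed.

End Quotient.

Arguments marked {G} T H _.

(** * Bridges *)

(** A relation is allowed so that the matching, defined on [T], need not be made a function on
    orbits. *)
Lemma leq_card_rel (A B : choiceType) (D : {fset A}) (E : {fset B})
    (rel_ab : A -> B -> Prop) :
  (forall a, a \in D -> exists2 b, b \in E & rel_ab a b) ->
  (forall a a' b, rel_ab a b -> rel_ab a' b -> a = a') ->
  (#|` D| <= #|` E|)%N.
Proof.
move=> tot inj; have [->|/fset0Pn[a0 a0D]] := eqVneq D fset0.
  by rewrite cardfs0.
have [b0 b0E _] := tot _ a0D.
have /choice[f fP] a : exists b, a \in D -> b \in E /\ rel_ab a b.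
  have [/tot[b bE ab]|_] := boolP (a \in D); first by exists b.
  by exists b0.
rewrite -(card_in_imfset imfset_key (f := f) (p := mem D)) /=; last first.
  move=> a a' /fP[_ ab] /fP[_ ab'] E'; apply: inj ab _; by rewrite E'.
apply: fsubset_leq_card; apply/fsubsetP => _ /imfsetP[a /= /fP[? _] ->] //.
Qed.

Section Bridges.
Variables (G : groupType) (T : gtree G) (lt : edge T -> edge T -> Prop).
Variable H : set G.
Notation X := (quotient_graph T H).

Definition bridge e :=
  ~ inessential H (comp (below lt setT e) (src e)) /\
  ~ inessential H (comp (below lt setT e) (tgt e)).

Definition bridges : set (edge X) := [set qe H e | e in bridge].

Lemma bridge_joins e v w : bridge e -> joins e v w ->
  ~ inessential H (comp (below lt setT e) v).
Proof. by move=> [? ?] [[<- _]|[_ <-]]. Qed.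

Hypotheses (triv : trivial_edge_stabilisers T)
  (ord : invariant_edge_order lt) (HH : is_subgroup H).

Lemma bridge_act e h : H h -> bridge e -> bridge (eact e h).
Proof.
have [_ HV _] := subgroupP HH => Hh.
have H1 v : ~ inessential H (comp (below lt setT e) v) ->
    ~ inessential H (comp (below lt setT (eact e h)) (vact v h)).
  move=> Ni i; apply: Ni.
  have := inessential_act ord HH (fun _ _ _ _ => I) (HV _ Hh) i.
  by rewrite eactK vactK.
by move=> [/H1 ? /H1 ?]; split; rewrite ?src_act ?tgt_act.
Qed.

Variables (M : set (edge X)) (r : vert X) (d : vert X -> nat).
Hypotheses (d0 : forall v, d v = 0%N <-> v = r)
  (d_up : forall v, v <> r -> exists e w, [/\ M e, joins e v w & d v = (d w).+1])
  (d_joins : forall e v w, M e -> joins e v w ->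
    d v = (d w).+1 \/ d w = (d v).+1)
  (d_uniq : forall e e' v w w', M e -> M e' -> joins e v w -> joins e' v w' ->
    d v = (d w).+1 -> d v = (d w').+1 -> e = e').
Variables (V0 : {fset vert X}) (E0 F0 : {fset edge X}).
Hypotheses (VE : rooted_pair M r d V0 E0)
  (F0M : forall e, e \in F0 -> ~ M e)
  (F0V : forall e v w, e \in F0 -> joins e v w -> v \in V0).

(** [EF] is the edge set of a finite connected piece of [T/H], [P] its preimage in [T], and [N] its
    non-bridges when only edges of [P] are allowed. *)
Let EF := (E0 `|` F0)%fset.
Let P : set (edge T) := [set e | qe H e \in EF].
Let N : {fset edge X} := [fset x in EF | `[< exists e v w, [/\ qe H e = x,
  joins e v w & inessential H (comp (below lt P e) v)] >]]%fset.

Let NP x : x \in N <-> x \in EF /\ exists e v w, [/\ qe H e = x,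
  joins e v w & inessential H (comp (below lt P e) v)].
Proof.
rewrite !inE; split=> [/andP[? /asboolP]//|[xEF ?]].
by rewrite xEF; exact/asboolP.
Qed.

Lemma card_EF : (#|` EF|.+1 = #|` V0| + #|` F0|)%N.
Proof.
have [_ _ -> memE0] := VE; rewrite addSn -(cardfsUI E0 F0).
suff -> : (E0 `&` F0)%fset = fset0 by rewrite cardfs0 addn0.
apply/fsetP => e; rewrite !inE; apply/negP => /andP[/memE0[Me _] /F0M]; exact.
Qed.

Lemma EF_joins x v w : x \in EF -> joins x v w -> v \in V0.
Proof.
have [_ closed _ memE0] := VE; rewrite inE => /orP[|xF]; last exact: F0V.
move=> /memE0[Mx [a [b [aV xab dab]]]] xvw.
have [[-> _]//|[-> _]] := joins_eq xvw xab.
exact: closed xab dab aV.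
Qed.

Lemma P_joins e v w : P e -> joins e v w -> qv H v \in V0.
Proof. by move=> Pe /(joins_qe H); exact: EF_joins. Qed.

Let PH e h : H h -> P e -> P (eact e h).
Proof. by move=> Hh; rewrite /P /= qe_act. Qed.

Let Pfin : finite_set [set eorbit H e | e in P].
Proof.
apply: (@sub_finite_set _ _ (val @` [set` EF])).
  by move=> _ [e Pe <-]; exists (qe H e).
exact/finite_image/finite_fset.
Qed.

(** Components only grow when [P] is enlarged to all edges, so essential ones stay essential. *)
Lemma unmatched_bridge x : x \in EF -> x \notin N -> bridges x.
Proof.
move=> xEF; have [e ex] := qe_surj x => /negP/NP Nx.
exists e => //; split=> i; apply: Nx; split=> //.
  exists e, (src e), (tgt e); split=> //; first exact: joins_src.
  by apply: inessentialS i => u; apply: conn_sub => f [].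
exists e, (tgt e), (src e); split=> //; first exact/joins_sym/joins_src.
by apply: inessentialS i => u; apply: conn_sub => f [].
Qed.

(** Each edge of [N] is matched, through [up], with an unmarked vertex of [V0], different edges with
    different vertices; the edges of [EF] outside [N] are bridges. *)
Lemma rank_le_bridges (A0 : {fset vert X}) (b : {fset edge X}) :
  {subset A0 <= V0} -> (forall x, x \in A0 -> marked T H x) ->
  bridges `<=` [set` b] -> (#|` A0| + #|` F0| <= #|` b|.+1)%N.
Proof.
move=> A0V A0m bB.
have NV : (#|` N| <= #|` (V0 `\` A0)%fset|)%N.
  apply: (@leq_card_rel _ _ _ _ (fun x y => exists e v,
      [/\ qe H e = x, qv H v = y & up lt H P v e])).
    move=> x /NP[xEF [e [v [w [ex evw iv]]]]].
    have Pe : P e by rewrite /P /= ex.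
    have [u [z [ueu euz]]] : exists u z, up lt H P u e /\ joins e u z.
      have [uv|uw] := up_onto triv ord HH Pfin Pe evw iv.
        by exists v, w.
      by exists w, v; split=> //; exact: joins_sym.
    exists (qv H u); last by exists e, u.
    rewrite inE (P_joins Pe euz) andbT; apply/negP => /A0m mu.
    apply: (marked_stab HH mu) => h Hh uh; exact: (up_unmarked ord ueu Hh uh).
  move=> x x' y [e [v [ex vy ue]]] [e' [v' [ex' vy' ue']]].
  have [h Hh v'E] : exists2 h, H h & v' = vact v h by apply: qvP; rewrite ?vy.
  rewrite v'E in ue'.
  have e'E := up_uniq ord (up_act ord HH PH Hh ue) ue'.
  by rewrite -ex -ex' -e'E qe_act.
have EFN : (#|` (EF `\` N)%fset| <= #|` b|)%N.
  apply: fsubset_leq_card; apply/fsubsetP => x; rewrite inE => /andP[xN xEF].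
  by apply: bB; exact: unmatched_bridge.
have NEF : (N `<=` EF)%fset by apply/fsubsetP => x /NP[].
have A0V' : (A0 `<=` V0)%fset by apply/fsubsetP.
have := card_EF; have := cardfsDS NEF; have := fsubset_leq_card NEF.
have := cardfsDS A0V'; have := fsubset_leq_card A0V'; move: NV EFN.
move: #|` N| #|` EF| #|` (EF `\` N)%fset| #|` V0| #|` A0| #|` (V0 `\` A0)%fset| #|` F0| #|` b|.
lia.
Qed.

(** * Retraction onto a finite piece and the reverse bound *)

Section Retraction.
Hypotheses (F0_all : forall e, ~ M e -> e \in F0)
  (marksV : forall x, marked T H x -> x \in V0).

(* As the edges outside [P] form trees hanging off [V0] and all marked vertices
   lie in [V0], pushing the hanging trees onto [V0] is compatible with [H]. *)
Lemma retraction : exists tau : vert T -> vert T,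
  [/\ forall v, qv H v \in V0 -> tau v = v,
      forall e, ~ P e -> tau (src e) = tau (tgt e) &
      forall v h, H h -> tau (vact v h) = vact (tau v) h].
Proof.
have [rV0 closed _ memE0] := VE; have [_ HV _] := subgroupP HH.
(* [par] moves a vertex one edge towards the root, except that vertices over [V0] stay fixed. *)
pose par_rel v w := (qv H v \in V0 /\ w = v) \/
  (qv H v \notin V0 /\ exists e, [/\ joins e v w, M (qe H e) &
     d (qv H v) = (d (qv H w)).+1]).
have /choice[par parP] v : exists w, par_rel v w.
  have [vV|vV] := boolP (qv H v \in V0); first by exists v; left.
  have vr : qv H v <> r by move=> E; rewrite E rV0 in vV.
  have [x [y [Mx xvy dv]]] := d_up vr; have [e ex] := qe_surj x.
  rewrite -ex in Mx xvy; have [v' [w' [ev'w' v'v w'y]]] := joins_lift xvy.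
  have [h Hh vE] := qvP HH v'v; exists (vact w' h); right; split=> //.
  exists (eact e h); rewrite qe_act // qv_act // w'y.
  by split=> //; rewrite vE; exact: joins_act.
have par_uniq v w w' : par_rel v w -> par_rel v w' -> w = w'.
  move=> [[vV ->]|[vV [e [evw Me dv]]]] [[vV' ->]|[vV' [e' [evw' Me' dv']]]] //.
  - by rewrite vV in vV'.
  - by rewrite vV' in vV.
  have [h Hh e'E] := qeP HH (d_uniq Me Me' (joins_qe H evw) (joins_qe H evw') dv dv').
  (* Vertices not over [V0] are unmarked, so [v] has trivial stabiliser and its parent edge has a
     unique lift at [v]. *)
  have vfree := @markedPn _ _ _ v (fun m => negP vV (marksV m)).
  rewrite e'E in evw'; have [[vh wh]|[vwh _]] := joins_eq evw' (joins_act h evw).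
    by rewrite wh (vfree h) ?vact1.
  by move: dv; rewrite vwh qv_act // => /eqP;
    rewrite -addn1 -[X in X == _]addn0 eqn_add2l.
have par_act v h : H h -> par (vact v h) = vact (par v) h.
  move=> Hh; apply: par_uniq (parP _) _; rewrite /par_rel qv_act //.
  have [[vV ->]|[vV [e [evw Me dv]]]] := parP v; first by left.
  right; split=> //; exists (eact e h); rewrite qe_act // qv_act //.
  by split=> //; exact: joins_act.
(* Each move lowers the distance to the root until [V0] is reached, so [d] moves suffice. *)
exists (fun v => iter (d (qv H v)) par v); split.
- move=> v vV; have pv : par v = v by apply: par_uniq (parP _) _; left.
  by elim: (d _) => //= n ->.
- move=> e NPe; have Me : M (qe H e).
    by apply: contrapT => /F0_all eF; apply: NPe; rewrite /P /= inE eF orbT.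
  have H1 v w : joins e v w -> d (qv H v) = (d (qv H w)).+1 ->
      iter (d (qv H v)) par v = iter (d (qv H w)) par w.
    move=> evw dv; rewrite dv iterSr; congr (iter _ _ _).
    apply: par_uniq (parP _) _; right; split; last by exists e.
    apply/negP => vV; apply: NPe; rewrite /P /= inE; apply/orP; left.
    by apply/memE0; split=> //; exists (qv H v), (qv H w); split=> //; exact: joins_qe.
  have [|/H1] := d_joins Me (joins_qe H (joins_src e)).
    by apply: H1; exact: joins_src.
  by move=> /(_ (joins_sym (joins_src e))).
- move=> v h Hh; rewrite qv_act //; elim: (d _) => //= n ->; exact: par_act.
Qed.

(** Each vertex of [V0] outside [A0] is matched with an edge of [N], injectively, and the edges of
    [b] avoid [N]; for both, the retraction transfers connections from [T] to [P]. *)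
Lemma bridges_lt_rank (A0 : {fset vert X}) (b : {fset edge X}) :
  {subset A0 <= V0} -> (forall x, marked T H x -> x \in A0) ->
  [set` b] `<=` bridges -> b != fset0 ->
  (forall x v w, x \in b -> joins x v w -> v \in V0) ->
  (#|` b|.+1 <= #|` A0| + #|` F0|)%N.
Proof.
move=> A0V A0m bB b0 bV; have [tau [tauV tauE tau_act]] := retraction.
have [H1 HV HM] := subgroupP HH.
have conn_tau Q v w : conn Q v w ->
    conn [set e | P e /\ Q e] (tau v) (tau w).
  apply: conn_map => e Qe; have [Pe|NPe] := pselect (P e); last first.
    by rewrite tauE //; exact: Conn0.
  rewrite !tauV ?(P_joins Pe (joins_src e)) //.
    by apply: conn1 (joins_src e).
  exact: (P_joins Pe (joins_sym (joins_src e))).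
(* For trivial [H] every component is inessential, so a bridge provides a nontrivial element. *)
have [h0 [Hh0 h0N1]] : exists h, H h /\ h <> 1.
  apply: contrapT => Htriv; have [x xb] := fset0Pn _ b0.
  have [e [Ns _] _] := bB _ xb; apply: Ns => u h Hh _ _.
  by apply: contrapT => hN1; apply: Htriv; exists h.
(* [P] joins all vertices over [V0], among them [v] and [v h0]. *)
have ess v : qv H v \in V0 -> ~ inessential H (comp P v).
  move=> vV iv; apply: h0N1; apply: (iv v h0 Hh0); first exact: Conn0.
  have := conn_tau _ _ _ (tree_conn v (vact v h0)).
  by rewrite !tauV ?qv_act //; apply: conn_sub => e [].
have VN : (#|` (V0 `\` A0)%fset| <= #|` N|)%N.
  apply: (@leq_card_rel _ _ _ _ (fun y x => exists v e,
      [/\ qe H e = x, qv H v = y, y \in V0 & up lt H P v e])).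
    move=> y; rewrite inE => /andP[yA yV]; have [v vy] := qv_surj y.
    have vfree h : H h -> vact v h = v -> h = 1.
      by apply: markedPn; rewrite vy => /A0m; exact/negP.
    have vV : qv H v \in V0 by rewrite vy.
    have [e ue] := up_exists triv ord HH Pfin vfree (ess v vV).
    have [Pe iv [w evw]] := up_edge ord ue.
    exists (qe H e); last by exists v, e.
    by apply/NP; split=> //; exists e, v, w.
  move=> y y' x [v [e [ex vy yV ue]]] [v' [e' [ex' vy' yV' ue']]].
  have [h Hh e'E] : exists2 h, H h & e' = eact e h by apply: qeP; rewrite ?ex.
  rewrite e'E in ue'.
  have vV : qv H (vact v h) \in V0 by rewrite qv_act // vy.
  have := up_inj triv ord HH PH Pfin (ess _ vV) (up_act ord HH PH Hh ue) ue'.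
  by move=> E; rewrite -vy' -E qv_act.
have bEF : {subset b <= EF `\` N}%fset.
  move=> x xb; have xEF : x \in EF.
    rewrite inE; have [Mx|/F0_all ->] := pselect (M x); last by rewrite orbT.
    apply/orP; left; have [_ _ _ memE0] := VE; apply/memE0; split=> //.
    have xs := joins_src x; have [dx|dx] := d_joins Mx xs.
      by exists (src x), (tgt x); split=> //; exact: bV xb xs.
    exists (tgt x), (src x); split=> //; last exact: joins_sym.
    exact: bV xb (joins_sym xs).
  rewrite inE xEF andbT; apply/negP => /NP[_ [e [v [w [ex evw iv]]]]].
  have [e1 be1 e1x] := bB _ xb.
  have [h Hh eE] : exists2 h, H h & e = eact e1 h by apply: qeP; rewrite ?ex.
  have Pe : P e by rewrite /P /= ex.
  have be : bridge e.
    by rewrite eE; exact: bridge_act.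
  (* The retraction commutes with [H], so it carries [u] and [u k] to such a pair in the component
     relative to [P]. *)
  apply: (bridge_joins be evw) => u k Hk vu vuk.
  have vV := P_joins Pe evw.
  apply: (iv (tau u) k Hk).
    have := conn_tau _ _ _ vu; rewrite tauV //; apply: conn_sub => f [? []].
    by split.
  have := conn_tau _ _ _ vuk; rewrite tauV // tau_act //.
  by apply: conn_sub => f [? []]; split.
have A0V' : (A0 `<=` V0)%fset by apply/fsubsetP.
have NEF : (N `<=` EF)%fset by apply/fsubsetP => x /NP[].
have bEF' : (#|` b| <= #|` (EF `\` N)%fset|)%N by apply/fsubset_leq_card/fsubsetP.
have := card_EF; have := cardfsDS NEF; have := fsubset_leq_card NEF.
have := cardfsDS A0V'; have := fsubset_leq_card A0V'; move: VN bEF'.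
move: #|` N| #|` EF| #|` (EF `\` N)%fset| #|` V0| #|` A0| #|` (V0 `\` A0)%fset| #|` F0| #|` b|.
lia.
Qed.

End Retraction.

End Bridges.

Arguments bridges {G T} lt H _.

(** * Reduced Kurosh rank *)

Local Open Scope ring_scope.
Local Open Scope ereal_scope.
Section ReducedRank.
Variables (R : realType) (G : groupType) (T : gtree G).
Variables (lt : edge T -> edge T -> Prop) (H : set G).
Notation X := (quotient_graph T H).
Hypotheses (triv : trivial_edge_stabilisers T)
  (ord : invariant_edge_order lt) (HH : is_subgroup H).

Lemma counting_neqNy (A : choiceType) (D : set A) : counting D != -oo :> \bar R.
Proof. by rewrite /counting; case: ifP. Qed.

Lemma counting_fset (A : choiceType) (D : {fset A}) :
  counting [set` D] = (#|` D|%fset%:R)%:E :> \bar R.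
Proof. by rewrite /counting asboolT // set_fsetK. Qed.

Lemma counting_infinite (A : choiceType) (D : set A) :
  ~ finite_set D -> counting D = +oo%E :> \bar R.
Proof. by move=> ?; rewrite /counting asboolF. Qed.

Lemma counting_image (A B : choiceType) (f : A -> B) (D : set A) :
  injective f -> counting (f @` D) = counting D :> \bar R.
Proof.
move=> inj; have [Dfin|Dinf] := pselect (finite_set D).
  rewrite /counting !asboolT //; last exact: finite_image.
  by rewrite fset_set_image // card_imfset.
rewrite !counting_infinite // => /finite_set_inj fD.
by apply/Dinf/fD => x y _ _ /inj.
Qed.

Lemma nontrivial_orbitsE : nontrivial_orbits T H R = counting (marked T H).
Proof.
rewrite -(counting_image (marked T H) val_inj) /nontrivial_orbits /marked.
by rewrite image_comp.
Qed.

(** [T/H] is nonempty, so [xget] yields a maximal subtree and not its default; it spans because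
    [T/H] is connected. *)
Lemma graph_rankE : exists M : set (edge X),
  [/\ graph_rank X R = counting (~` M), acyclic M &
      forall x y, conn M x y].
Proof.
have /subtreeE[[v0 _] _ _ _] := gtree_tree T.
pose Y := xget (set0, set0) [set Y | @is_maximal_subtree X Y].
have maxY : is_maximal_subtree Y.
  by apply: xgetPex; exact: exists_maximal_subtree (qv H v0).
have spanY := maximal_subtree_spanning (@quotient_conn _ T H) maxY.
have [/subtreeE[_ _ cY aY] _] := maxY.
by exists Y.2; split=> // x y; apply: cY; rewrite spanY.
Qed.

(** The finite pieces come from rooted pairs containing [A0] and the ends of [F0], and for the
    second bound also those of [b]. *)
Lemma rank_bounds : exists M : set (edge X),
  [/\ graph_rank X R = counting (~` M),
      forall (A0 : {fset vert X}) (F0 b : {fset edge X}),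
        [set` A0] `<=` marked T H -> [set` F0] `<=` ~` M ->
        bridges lt H `<=` [set` b] -> (#|` A0| + #|` F0| <= #|` b|.+1)%N &
      forall (A0 : {fset vert X}) (F0 b : {fset edge X}),
        marked T H `<=` [set` A0] -> ~` M `<=` [set` F0] ->
        [set` A0] `<=` marked T H -> [set` F0] `<=` ~` M ->
        [set` b] `<=` bridges lt H -> b != fset0 ->
        (#|` b|.+1 <= #|` A0| + #|` F0|)%N].
Proof.
have [M [rankM aM cM]] := graph_rankE.
have /subtreeE[[v0 _] _ _ _] := gtree_tree T.
have [d [d0 d_up d_joins d_uniq]] := rooted_tree (qv H v0) aM cM.
pose ends (F : {fset edge X}) := map (@src X) F ++ map (@tgt X) F.
have endsP (F : {fset edge X}) e x y : e \in F -> joins e x y -> x \in ends F.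
  move=> eF exy; rewrite mem_cat; case: exy => [[<- _]|[_ <-]]; first by rewrite map_f.
  by rewrite (map_f (@tgt X)) ?orbT.
exists M; split=> //.
- move=> A0 F0 b AM FM Bb.
  have [V [E [VE WV]]] := rooted_pair_exists d0 d_up d_uniq (A0 ++ ends F0).
  apply: (rank_le_bridges triv ord HH VE) => //.
  + move=> e x y eF exy; apply: WV.
    by rewrite mem_cat; apply/orP; right; exact: endsP eF exy.
  + by move=> x xA; apply: WV; rewrite mem_cat xA.
- move=> A0 F0 b MA MF AM FM bB bN.
  have [V [E [VE WV]]] :=
    rooted_pair_exists d0 d_up d_uniq (A0 ++ ends F0 ++ ends b).
  have AV : {subset A0 <= V} by move=> x xA; apply: WV; rewrite mem_cat xA.
  apply: (bridges_lt_rank triv ord HH d_up d_joins d_uniq VE) bN _ => //.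
  + move=> e x y eF exy; apply: WV.
    rewrite mem_cat; apply/orP; right; rewrite mem_cat; apply/orP; left.
    exact: endsP eF exy.
  + by move=> x /MA /AV.
  + move=> e x y eF exy; apply: WV.
    rewrite mem_cat; apply/orP; right; rewrite mem_cat; apply/orP; right.
    exact: endsP eF exy.
Qed.

Lemma reduced_kurosh_rankE :
  reduced_kurosh_rank T H R = counting (bridges lt H).
Proof.
have [M [rankM le_bridges lt_rank]] := rank_bounds.
rewrite /reduced_kurosh_rank /kurosh_rank nontrivial_orbitsE rankM.
have large (b : {fset edge X}) (A0 : {fset vert X}) (F0 : {fset edge X}) :
    bridges lt H `<=` [set` b] ->
    [set` A0] `<=` marked T H -> [set` F0] `<=` ~` M ->
    (#|` b|.+1 < #|` A0| + #|` F0|)%N -> False.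
  by move=> bB AM FM; rewrite ltnNge le_bridges.
have [Afin|Ainf] := pselect (finite_set (marked T H)); last first.
  rewrite !(counting_infinite Ainf) [in RHS]counting_infinite; last first.
    move=> /finite_fsetP[b bE].
    (* The first bound allows one marked vertex more than bridges, so two more contradict it. *)
    have [A0 AM cardA] := infinite_set_fset #|` b|.+2 Ainf.
    by apply: (large b A0 fset0); rewrite ?bE ?cardfs0 ?addn0.
  by rewrite addye ?counting_neqNy // addye // maxey.
have [Ffin|Finf] := pselect (finite_set (~` M)); last first.
  rewrite (counting_infinite Finf) [in RHS]counting_infinite; last first.
    move=> /finite_fsetP[b bE].
    have [F0 FM cardF] := infinite_set_fset #|` b|.+2 Finf.
    by apply: (large b fset0 F0); rewrite ?bE ?cardfs0 ?add0n.
  by rewrite addey ?counting_neqNy // addye // maxey.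
have [[A0 AE] [F0 FE]] := (proj1 finite_fsetP Afin, proj1 finite_fsetP Ffin).
rewrite AE FE !counting_fset -EFinD -natrD.
have AM : [set` A0] `<=` marked T H by rewrite AE.
have FM : [set` F0] `<=` ~` M by rewrite FE.
have bound (b : {fset edge X}) : [set` b] `<=` bridges lt H -> b != fset0 ->
    (#|` b|.+1 <= #|` A0| + #|` F0|)%N.
  by apply: lt_rank => //; rewrite ?AE ?FE.
have [Bfin|Binf] := pselect (finite_set (bridges lt H)); last first.
  have [b bB bcard] := infinite_set_fset (#|` A0| + #|` F0|).+1 Binf.
  have bN : b != fset0 by rewrite -cardfs_gt0; apply: leq_trans bcard.
  by have := bound b bB bN; rewrite ltnNge (leq_trans _ bcard).
have [b bE] := proj1 finite_fsetP Bfin; rewrite bE counting_fset.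
have le : (#|` A0| + #|` F0| <= #|` b|.+1)%N by apply: le_bridges; rewrite ?bE.
have [b0|bN] := eqVneq b fset0.
  (* Without bridges the Kurosh rank is 0 or 1, and both reduce to 0. *)
  move: le; rewrite b0 cardfs0; case: (_ + _)%N => [_|[_|//]].
    by rewrite !mulr0n sub0r max_l // lee_fin lerN10.
  by rewrite mulr0n mulr1n subrr maxxx.
have -> : (#|` A0| + #|` F0|)%N = #|` b|.+1.
  by apply/eqP; rewrite eqn_leq le bound // bE.
by rewrite -natr1 addrK max_r // lee_fin ler0n.
Qed.

End ReducedRank.

(** * Double cosets *)

Section Counting.
Variable R : realType.

Lemma counting0 (A : choiceType) : counting (set0 : set A) = 0 :> \bar R.
Proof. by rewrite /counting asboolT // fset_set0. Qed.

Lemma counting_ge0 (A : choiceType) (D : set A) : 0 <= counting D :> \bar R.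
Proof. by rewrite /counting; case: ifP => _; rewrite ?leey ?lee_fin. Qed.

(** In this form [esum_esum] turns the sum over double cosets into the size of a disjoint union. *)
Lemma counting_esum (A : choiceType) (D : set A) :
  counting D = \esum_(x in D) (1 : \bar R).
Proof.
have sum1 (X : {fset A}) : \sum_(x \in [set` X]) (1 : \bar R) = (#|` X|%fset%:R)%:E.
  rewrite (fsbig_finite _ (fun=> 1)) //= set_fsetK sumEFin big_const_seq count_predT.
  by rewrite iter_addr_0.
have [/finite_fsetP[X ->]|Dinf] := pselect (finite_set D).
  by rewrite esum_fset // sum1 counting_fset.
rewrite counting_infinite //; apply/esym/eq_infty => r.
have [X XD cardX] := infinite_set_fset (Num.truncn r).+1 Dinf.
apply: esum_ge; exists [set` X]; first by split.
rewrite sum1 lee_fin; apply: ltW; apply: lt_le_trans (truncnS_gt r) _.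
by rewrite ler_nat.
Qed.

Lemma leq_counting_rel (A B : choiceType) (D : set A) (E : set B)
    (rel_ab : A -> B -> Prop) :
  (forall a, D a -> exists2 b, E b & rel_ab a b) ->
  (forall a a' b, rel_ab a b -> rel_ab a' b -> a = a') ->
  counting D <= counting E :> \bar R.
Proof.
move=> tot inj; have [|Einf] := pselect (finite_set E); last first.
  by rewrite (counting_infinite _ Einf) leey.
move=> /finite_fsetP[b bE]; subst E.
have le (a : {fset A}) : [set` a] `<=` D -> (#|` a|%fset <= #|` b|%fset)%N.
  by move=> aD; apply: (leq_card_rel _ inj) => x xa; exact: (tot _ (aD _ xa)).
have [/finite_fsetP[a aE]|Dinf] := pselect (finite_set D).
  by rewrite aE !counting_fset lee_fin ler_nat le // aE.
have [a aD] := infinite_set_fset #|` b|.+1 Dinf.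
by rewrite ltnNge le.
Qed.

Lemma counting_setX (A B : choiceType) (D : set A) (E : set B) :
  counting (D `*` E) <= counting D * counting E :> \bar R.
Proof.
have pos (C : choiceType) (F : set C) x : F x -> 0 < counting F :> \bar R.
  move=> Fx; rewrite /counting; case: ifPn => [/asboolP Ffin|_].
    rewrite lte_fin ltr0n cardfs_gt0; apply/fset0Pn; exists x.
    by rewrite in_fset_set // mem_set.
  exact: ltry.
have [[a Da]|D0] := pselect (D !=set0); last first.
  suff -> : D `*` E = set0 by rewrite counting0 mule_ge0 ?counting_ge0.
  by apply/seteqP; split=> // -[x y] [Dx _]; case: D0; exists x.
have [[b Eb]|E0] := pselect (E !=set0); last first.
  suff -> : D `*` E = set0 by rewrite counting0 mule_ge0 ?counting_ge0.
  by apply/seteqP; split=> // -[x y] [_ Ey]; case: E0; exists y.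
have [Dfin|Dinf] := pselect (finite_set D); last first.
  by rewrite (counting_infinite _ Dinf) gt0_mulye ?leey //; exact: pos Eb.
have [Efin|Einf] := pselect (finite_set E); last first.
  by rewrite (counting_infinite _ Einf) gt0_muley ?leey //; exact: pos Da.
rewrite /counting !asboolT //; last exact: finite_setX.
rewrite -EFinM lee_fin -natrM ler_nat fset_setX //.
rewrite -(size_allpairs pair); apply: uniq_leq_size (fset_uniq _) _ => -[x y].
by rewrite in_fsetM => /andP[? ?]; exact: allpairs_f.
Qed.

End Counting.

Lemma conj_set_subgroup (G : groupType) (H K : set G) (g : G) :
  is_subgroup H -> is_subgroup K -> is_subgroup (conj_set H g `&` K).
Proof.
move=> /subgroupP[H1 HV HM] /subgroupP[K1 KV KM]; split.
  by apply/mem_set; split=> //; exists 1%g => //; rewrite conj1g.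
move=> _ _ /set_mem[[a Ha <-] Ka] /set_mem[[b Hb <-] Kb]; apply/mem_set.
split; last exact: KM _ _ Ka (KV _ Kb).
by exists (a / b)%g; [exact: HM _ _ Ha (HV _ Hb)|rewrite conjMg conjVg].
Qed.

Section BridgeCount.
Local Open Scope group_scope.
Variables (R : realType) (G : groupType) (T : gtree G).
Variables (lt : edge T -> edge T -> Prop).
Hypothesis (ord : invariant_edge_order lt).

(** Unlike [bridges], these sets have the same type for all subgroups, as the sum over double cosets
    requires. *)
Definition bridge_orbits (H : set G) := [set eorbit H e | e in bridge lt H].

Lemma counting_bridges (H : set G) :
  counting (bridges lt H) = counting (bridge_orbits H) :> \bar R.
Proof.
by rewrite -(counting_image _ (bridges lt H) val_inj) /bridges image_comp.
Qed.

Lemma bridge_sub (H H' : set G) e : H' `<=` H -> bridge lt H' e -> bridge lt H e.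
Proof.
by move=> HH' [Ns Nt]; split=> i; [apply: Ns|apply: Nt] => u h /HH'; exact: i.
Qed.

(** Translation by [g^-1] preserves the order and turns the action of [H^g] into that of [H]. *)
Lemma bridge_conj (H : set G) e g : bridge lt (conj_set H g) e ->
  bridge lt H (eact e g^-1).
Proof.
have [_ _ _ lt_act] := ord.
have H1 v : inessential H (comp (below lt setT (eact e g^-1)) (vact v g^-1)) ->
    inessential (conj_set H g) (comp (below lt setT e) v).
  move=> i u _ [h Hh <-] vu vuh.
  have push x : conn (below lt setT e) v x ->
      conn (below lt setT (eact e g^-1)) (vact v g^-1) (vact x g^-1).
    by apply: conn_act => f [_ fe]; split=> //; exact: lt_act.
  rewrite (i (vact u g^-1) h Hh (push _ vu)) ?conj1g //.
  rewrite /comp /= -vactM; have := push _ vuh.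
  by rewrite -vactM conjgE -!mulgA mulgV mulg1.
by move=> [Ns Nt]; split=> i; [apply: Ns|apply: Nt]; apply: H1;
  rewrite -?src_act -?tgt_act.
Qed.

Lemma esum_bridges (H K S : set G) :
  trivial_edge_stabilisers T -> is_subgroup H -> is_subgroup K ->
  double_coset_reps H K S ->
  (\esum_(g in S) counting (bridges lt (conj_set H g `&` K))
    <= counting (bridges lt H) * counting (bridges lt K) :> \bar R)%E.
Proof.
move=> triv HH HK reps; rewrite !counting_bridges.
under eq_esum do rewrite counting_bridges counting_esum.
rewrite esum_esum // -counting_esum.
apply: le_trans (counting_setX _ _ _).
apply: (@leq_counting_rel _ _ _ _ _ (fun x y => S x.1 /\ exists e,
  [/\ x.2 = eorbit (conj_set H x.1 `&` K) e, y.1 = eorbit H (eact e x.1^-1) &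
      y.2 = eorbit K e])).
  move=> [g A] [/= Sg [e be <-]].
  exists (eorbit H (eact e g^-1), eorbit K e); last by split=> //; exists e.
  split=> /=; [exists (eact e g^-1) => //|exists e => //].
    by apply: bridge_conj; apply: bridge_sub be => h [].
  by apply: bridge_sub be => h [].
move=> [g A] [g' A'] [B C] [/= Sg [e [-> -> ->]]] [/= Sg' [e' [-> E1 E2]]].
have [h Hh e'gE] := eorbitP HH E1; have [k Kk e'E] := eorbitP HK E2.
have [H1 HV HM] := subgroupP HH; have [K1 _ _] := subgroupP HK.
(* Both sides carry [e] to the same edge, [e' g'^-1]. *)
have {}e'gE : k * g'^-1 = g^-1 * h.
  by apply: (eact_inj (e := e) triv); rewrite !eactM -e'E.
(* So [g] and [g'] represent the same double coset and are equal; then [k = h ^ g] lies in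
   [H^g & K], and [e] and [e k] have the same orbit. *)
have gk : g * k = h * g' by rewrite -[k](mulgVK g') e'gE !mulgA mulgV mul1g.
have [g0 [_ g0_uniq]] := reps g'.
have gg' : g = g'.
  rewrite -[LHS](g0_uniq g); first apply: g0_uniq; split=> //.
    by exists 1, 1; rewrite mul1g mulg1.
  by exists h^-1, k; split=> //; [exact: HV|rewrite -mulgA gk mulKg].
subst g'; congr (_, _); rewrite e'E.
have kE : k = h ^ g by rewrite conjgE -gk mulKg.
have [_ LV LM] := subgroupP (conj_set_subgroup g HH HK).
have Lk : (conj_set H g `&` K) k by split=> //; exists h.
apply/seteqP; split=> _ [l Ll <-].
  by exists (k^-1 * l); rewrite -?eactM ?mulVKg //; exact: LM _ _ (LV _ Lk) Ll.
by exists (k * l); rewrite ?eactM //; exact: LM.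
Qed.

End BridgeCount.

Theorem theoremA (R : realType) (G : groupType) (T : gtree G)
    (H K S : set G) :
  right_orderable G ->
  trivial_edge_stabilisers T ->
  is_subgroup H -> is_subgroup K ->
  double_coset_reps H K S ->
  \esum_(g in S) reduced_kurosh_rank T (conj_set H g `&` K) R
    <= reduced_kurosh_rank T H R * reduced_kurosh_rank T K R.
Proof.
move=> orderG triv HH HK reps.
have [lt ord] := exists_invariant_edge_order orderG triv.
rewrite !(reduced_kurosh_rankE R triv ord) //.
under eq_esum => g _.
  rewrite (reduced_kurosh_rankE R triv ord (conj_set_subgroup g HH HK)); over.
exact: esum_bridges.
Qed.
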